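(* For every integer $n>25000$, every $\frac{1}{6000}$-dense partial Latin square of order $n$ is completable.
   Context: A Latin square of order $n$ is an $n\times n$ array filled with symbols from $\{1,\dots,n\}$ such that no symbol is repeated in any row or column. A partial Latin square of order $n$ is an $n\times n$ array in which each cell is either blank or contains one symbol from $\{1,\dots,n\}$, such that no symbol is repeated in any row or column. It is completable if its blank cells can be filled so that the resulting array is a Latin square. A partial Latin square of order $n$ is $\epsilon$-dense if each row contains at most $\epsilon n$ filled (nonblank) cells, each column contains at most $\epsilon n$ filled cells, and each symbol occurs in at most $\epsilon n$ cells. *)

(* Defs.v *)
From mathcomp Require Import all_boot all_order all_algebra.
Set Implicit Arguments.
Unset Strict Implicit.
Unset Printing Implicit Defensive.
Import Order.TTheory GRing.Theory Num.Theory.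
Local Open Scope ring_scope.

(* Rows, columns and symbols are all indexed by 'I_n = {0, ..., n-1} instead of
   {1, ..., n}. *)
Definition latin_square (n : nat) (L : 'M['I_n]_n) : Prop :=
  (forall i j j' : 'I_n, L i j = L i j' -> j = j') /\
  (forall j i i' : 'I_n, L i j = L i' j -> i = i').

(* None is a blank cell. *)
Definition partial_latin_square (n : nat) (P : 'M[option 'I_n]_n) : Prop :=
  (forall i j j' s : 'I_n, P i j = Some s -> P i j' = Some s -> j = j') /\
  (forall j i i' s : 'I_n, P i j = Some s -> P i' j = Some s -> i = i').

Definition completable (n : nat) (P : 'M[option 'I_n]_n) : Prop :=
  exists L : 'M['I_n]_n,
    latin_square L /\ (forall i j s : 'I_n, P i j = Some s -> L i j = s).

Definition eps_dense (eps : rat) (n : nat) (P : 'M[option 'I_n]_n) : Prop :=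
  [/\ forall i : 'I_n, #|[set j : 'I_n | P i j != None]|%:R <= eps * n%:R,
      forall j : 'I_n, #|[set i : 'I_n | P i j != None]|%:R <= eps * n%:R
    & forall s : 'I_n,
        #|[set c : 'I_n * 'I_n | P c.1 c.2 == Some s]|%:R <= eps * n%:R].

(* Main.v *)
Require Import Defs.
From mathcomp Require Import all_boot all_order all_algebra.
From mathcomp Require Import zify ring lra.
Set Implicit Arguments.
Unset Strict Implicit.
Unset Printing Implicit Defensive.
Import Order.TTheory GRing.Theory Num.Theory.

(* Latin squares are treated as sets of triples (row, column, symbol), symmetrically in the three
   coordinates. The entries of P are inserted one at a time into a Latin square that starts out
   as a small perturbation of a square on Z_2^2 x Z_m, with m odd and n - 4m <= 7. In that base
   square, for three quarters of all triples (i, j, k) one can put symbol k into cell (i, j) by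
   switching a single intercalate.

   Switching {r, r'} x {c, c'} x {s, s'} inserts (r, c, s) at the price of four triples, some of
   which may themselves have to be inserted beforehand. Inserting (r, c, s) reduces to inserting
   (r, d, s) and (r', c, s), with d free; each of these to inserting two triples with only one
   prescribed coordinate; and each of those to inserting two triples through intercalates of the
   base square. All auxiliary insertions cancel, and 46 triples of the present square get lost.

   Each of the eight triples inserted last runs bijectively over all triples when the free
   parameters vary. So it does not matter how the triples lost so far are distributed over the
   lines: since at most n^3 / 30 triples can no longer be inserted directly, counting yields
   parameters for which everything works and no previously inserted entry of P is disturbed. *)

(** * Trades *)

Section Trades.
Local Open Scope ring_scope.
Variable T : finType.
Implicit Types (i j k : T) (t u : T * T * T) (R : seq (T * T * T)).

Definition zero_marginals (D : T -> T -> T -> int) :=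
  [/\ forall i j, \sum_k D i j k = 0,
      forall j k, \sum_i D i j k = 0
    & forall i k, \sum_j D i j k = 0].

(* Removing the triples in [R] can be compensated by adding triples, [t] among them: [D] is the
   change of multiplicities. *)
Definition trade t R :=
  exists2 D, zero_marginals D &
    forall i j k, (t == (i, j, k))%:R - (count_mem (i, j, k) R)%:R <= D i j k.

Lemma sum_delta_diff i i' : \sum_j ((i == j)%:R - (i' == j)%:R : int) = 0.
Proof.
rewrite sumrB; apply/eqP; rewrite subr_eq0; apply/eqP.
have d x : \sum_j (x == j)%:R = 1 :> int.
  rewrite (bigD1 x) //= eqxx big1 ?addr0 // => j; by rewrite eq_sym => /negPf ->.
by rewrite !d.
Qed.

(** The product of three differences sums to zero along every line because one of its factors does.
    Coinciding parameters are allowed: the product is then zero, and [(i, j, k)] itself occurs in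
    the list. *)
Lemma trade_oct i j k i' j' k' :
  trade (i, j, k) [:: (i, j, k'); (i, j', k); (i', j, k); (i', j', k')].
Proof.
exists (fun x y z => ((i == x)%:R - (i' == x)%:R) * ((j == y)%:R - (j' == y)%:R)
                     * ((k == z)%:R - (k' == z)%:R)).
  split=> x y.
  - by rewrite -mulr_sumr sum_delta_diff mulr0.
  - by rewrite -mulr_suml -mulr_suml sum_delta_diff !mul0r.
  - by rewrite -mulr_suml -mulr_sumr sum_delta_diff mulr0 mul0r.
move=> x y z /=; rewrite !xpair_eqE.
by case: (i == x); case: (i' == x); case: (j == y); case: (j' == y);
  case: (k == z); case: (k' == z).
Qed.

(** Add the two changes: the debt at [u] left by the first is paid by the second. As [u] need not
    lie in the square, auxiliary insertions cancel in this way. *)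
Lemma trade_cut t u R R' : trade t (u :: R) -> trade u R' -> trade t (R ++ R').
Proof.
case=> D [D1 D2 D3] hD [D' [D1' D2' D3'] hD'].
exists (fun i j k => D i j k + D' i j k).
  by split=> x y; rewrite big_split /= ?(D1, D2, D3) ?(D1', D2', D3').
move=> i j k; have /= := lerD (hD i j k) (hD' i j k).
by rewrite count_cat !natrD; lra.
Qed.

Lemma trade_perm t R R' : perm_eq R R' -> trade t R -> trade t R'.
Proof.
by move=> /permP pR [D D0 hD]; exists D => // i j k; rewrite -pR.
Qed.

Lemma trade_cut_at t u A B R :
  trade t (A ++ u :: B) -> trade u R -> trade t (A ++ R ++ B).
Proof.
move=> tA tu; have pA : perm_eq (A ++ u :: B) (u :: A ++ B).
  exact: permEl (perm_catCA A [:: u] B).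
have := trade_cut (trade_perm pA tA) tu; apply: trade_perm.
by rewrite -catA perm_cat2l perm_catC.
Qed.

Definition rot3 t := (t.1.2, t.2, t.1.1).

Lemma rot3_inj : injective rot3.
Proof. by move=> [[i j] k] [[i' j'] k'] [-> -> ->]. Qed.

Lemma trade_rot t R : trade t R -> trade (rot3 t) (map rot3 R).
Proof.
case=> D [D1 D2 D3] hD; exists (fun j k i => D i j k); first by split=> x y.
move=> j k i; have -> : (j, k, i) = rot3 (i, j, k) by [].
rewrite (inj_eq rot3_inj) count_map (eq_count (a2 := pred1 (i, j, k))) // => u.
by rewrite /= (inj_eq rot3_inj).
Qed.

(** The square together with its two conjugates: [g] finds the row and [h] the column. With this
    cyclic order of arguments, rotating the coordinates merely permutes [f], [g], [h]. *)
Definition latin3 (f g h : T -> T -> T) := forall i j k,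
  (f i j == k) = (g j k == i) /\ (f i j == k) = (h k i == j).

Lemma latin3_rot f g h : latin3 f g h -> latin3 g h f.
Proof. by move=> L j k i; case: (L i j k) => <- <-. Qed.

Definition lmem (f : T -> T -> T) t := f t.1.1 t.1.2 == t.2.

Lemma sum1_pick (F : T -> int) : (forall i, 0 <= F i) -> \sum_i F i = 1 ->
  exists i, forall j, (0 < F j) = (i == j).
Proof.
move=> F0 F1; have [i Fi|] := pickP (fun i => 0 < F i).
  exists i => j; case: eqP => [<- //|/eqP ij].
  move: F1; rewrite (bigD1 i) //= (bigD1 j) 1?eq_sym //=.
  have s0 : 0 <= \sum_(k | (k != i) && (k != j)) F k by apply: sumr_ge0.
  move=> e; apply/negbTE/negP => Fj; move: Fi Fj e s0; move: (F i) (F j) (\sum_(_ | _) _) => x y S; lia.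
move=> N; exfalso; move: F1; rewrite big1 // => i _.
by have := F0 i; have := N i; rewrite le_eqVlt => -> /=; rewrite orbF => /eqP.
Qed.

(** The indicator of the square plus [D] is nonnegative, since [R] lies in the square without
    repetition, and has all line sums 1. Such an integer array is the indicator of a Latin
    square. *)
Lemma apply_trade f g h t R : latin3 f g h -> trade t R -> uniq R ->
  (forall u, u \in R -> lmem f u) -> t \notin R ->
  exists f' g' h', [/\ latin3 f' g' h', lmem f' t &
    forall u, lmem f u -> u \notin R -> lmem f' u].
Proof.
move=> L [D [D1 D2 D3] hD] uR RL tR.
pose F i j k := (f i j == k)%:R + D i j k.
have Fge i j k : 0 <= F i j k.
  have := hD i j k; rewrite /F count_uniq_mem //.
  have := RL (i, j, k); rewrite /lmem /=.
  case: (_ \in R) => [/(_ isT) ->|_]; case: (t == _) => /=; case: (f i j == k); lia.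
have one (x : T) : \sum_y ((x == y)%:R : int) = 1.
  by rewrite (bigD1 x) //= eqxx big1 ?addr0 // => y; rewrite eq_sym => /negPf ->.
have F1 i j : \sum_k F i j k = 1.
  by rewrite big_split /= D1 addr0 one.
have F2 j k : \sum_i F i j k = 1.
  rewrite big_split /= D2 addr0 -[RHS](one (g j k)).
  by apply: eq_bigr => i _; rewrite (L i j k).1.
have F3 i k : \sum_j F i j k = 1.
  rewrite big_split /= D3 addr0 -[RHS](one (h k i)).
  by apply: eq_bigr => j _; rewrite (L i j k).2.
(* The default [d] is never returned where [pkE] applies, because exactly one value of [G] is
   positive there. *)
pose pk (G : T -> int) (d : T) := odflt d [pick x | 0 < G x].
have pkE G d : (forall i, 0 <= G i) -> \sum_i G i = 1 ->
    forall x, (pk G d == x) = (0 < G x).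
  move=> G0 G1 x; have [i hi] := sum1_pick G0 G1; rewrite hi /pk.
  case: pickP => [z|/(_ i)]; first by rewrite hi => /eqP ->.
  by rewrite hi eqxx.
exists (fun i j => pk (F i j) i), (fun j k => pk (fun i => F i j k) j),
  (fun k i => pk (fun j => F i j k) k); split.
- by move=> i j k; rewrite !pkE.
- case: t tR hD {RL} => [[i j] k] tR hD; rewrite /lmem /= pkE //.
  have := hD i j k; rewrite eqxx (count_memPn tR) /F; case: (f i j == k) => /=; lia.
- move=> [[i j] k]; rewrite /lmem /= pkE // => fk uR'.
  by have := hD i j k; rewrite (count_memPn uR') /F fk; case: (t == _) => /=; lia.
Qed.

End Trades.
Arguments rot3 {T} t.

(** * Cancellation laws of the three operations *)

Section LatinTheory.
Variables (T : finType) (f g h : T -> T -> T).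
Hypothesis L : latin3 f g h.

Lemma latin_gf i j : g j (f i j) = i. Proof. by apply/eqP; rewrite -(L i j _).1. Qed.

Lemma latin_hf i j : h (f i j) i = j. Proof. by apply/eqP; rewrite -(L i j _).2. Qed.

Lemma latin_fg j k : f (g j k) j = k. Proof. by apply/eqP; rewrite (L _ j k).1. Qed.

Lemma latin_fh k i : f i (h k i) = k. Proof. by apply/eqP; rewrite (L i _ k).2. Qed.

Lemma latin_hg j k : h k (g j k) = j.
Proof. by rewrite -{1}[k](latin_fg j) latin_hf. Qed.

Lemma latin_gh k i : g (h k i) k = i.
Proof. by rewrite -{2}[k](latin_fh k i) latin_gf. Qed.

End LatinTheory.

(** * Placing a triple on one line *)

Section Lines.
Variable T : finType.
Implicit Types (i j k : T) (t u : T * T * T) (R U : seq (T * T * T)).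
Implicit Types (G W B : T -> T -> T -> bool).

(** The union bound, in the form in which every free parameter is chosen. *)
Lemma exists_avoid (ps : seq (pred T)) : sumn [seq #|p| | p : pred T <- ps] < #|T| ->
  exists x, all (fun p : pred T => ~~ p x) ps.
Proof.
move=> lt; have [x xP|no] := pickP [pred x | all (fun p : pred T => ~~ p x) ps].
  by exists x.
exfalso; move: lt; rewrite ltnNge => /negP; apply.
have {no} no x : has (fun p : pred T => p x) ps.
  by apply: contraFT (no x); rewrite -all_predC.
have /subset_leq_card : T \subset [pred x | has (fun p : pred T => p x) ps].
  by apply/subsetP => x _; rewrite inE.
move/leq_trans; apply; elim: ps {no} => [|p ps IH] /=.
  by rewrite (eq_card0 (A := _)).
apply: leq_trans (leq_add (leqnn _) IH).
rewrite -cardUI; apply: leq_trans (leq_addr _ _).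
by apply: subset_leq_card; apply/subsetP => x; rewrite !inE.
Qed.

Lemma card_inj_mem (S : eqType) (phi : T -> S) (s : seq S) : injective phi ->
  #|[pred x | phi x \in s]| <= size s.
Proof.
move=> inj; rewrite cardE -(size_map phi); apply: uniq_leq_size.
  by rewrite map_inj_uniq // enum_uniq.
by move=> y /mapP[x]; rewrite mem_enum inE => xs ->.
Qed.

(* Switching one intercalate contained in [G] inserts [(i, j, k)]. *)
Definition good G i j k := exists i' j' k',
  [&& i != i', j != j', k != k', G i j k', G i j' k, G i' j k & G i' j' k'].

Lemma good_rot G i j k : good G i j k <-> good (fun j k i => G i j k) j k i.
Proof.
by split=> [[i' [j' [k']]] | [j' [k' [i']]]] => /and5P[a b c d /and3P[e x y]];
  [exists j', k', i' | exists i', j', k']; apply/and5P; split=> //; apply/and3P.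
Qed.

Definition cells (G : T -> T -> T -> bool) : pred (T * T * T) :=
  fun t => G t.1.1 t.1.2 t.2.

Lemma place_on_sym f g h G W B U i1 j1 i2 j2 l :
  latin3 f g h -> (forall i j k, G i j k -> f i j = k) ->
  (forall i j k, ~~ W i j k -> ~~ B i j k -> good G i j k) ->
  (forall i j, 4 * #|[pred k | W i j k]| <= #|T|) ->
  f i1 j1 = l -> f i2 j2 = l -> i1 != i2 ->
  (i1, j2, f i1 j2) \notin U -> (i2, j1, f i2 j1) \notin U -> size U <= 60 ->
  2 * #|[pred k | B i1 j2 k || B i2 j1 k]| + 400 < #|T| ->
  exists R, [/\ uniq R, size R = 8, all (cells G) R, all (fun u => u \notin U) R
    & trade (i1, j2, l) [:: (i1, j1, l), (i2, j2, l) & R]].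
Proof.
move=> L GL gd hW f1 f2 ne U1 U2 sU rich.
have Lh k i j : h k i = j -> f i j = k by move=> e; apply/eqP; rewrite (L i j k).2 e.
have hL k i j : f i j = k -> h k i = j by move/eqP; rewrite (L i j k).2 => /eqP.
have gL k i j : f i j = k -> g j k = i by move/eqP; rewrite (L i j k).1 => /eqP.
have hinj i : injective (h^~ i) by move=> k k' /= e; rewrite -(Lh _ _ _ e) (Lh _ _ _ erefl).
pose sy := [seq u.2 | u <- U]; pose co := [seq u.1.2 | u : T * T * T <- U].
(* Each [W] excludes at most a quarter of the symbols, and [B] fewer than half of them minus 200.
   These 200 cover the remaining 1 + 3 * 60 exclusions. *)
have lt : #|[pred k | W i1 j2 k]| + (#|[pred k | W i2 j1 k]| +
    (#|[pred k | B i1 j2 k || B i2 j1 k]| + (#|[pred k | k \in [:: l]]| +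
    (#|[pred k | k \in sy]| + (#|[pred k | h k i1 \in co]| +
    (#|[pred k | h k i2 \in co]| + 0)))))) < #|T|.
  have c1 := card_inj_mem [:: l] (@inj_id T).
  have c2 := card_inj_mem sy (@inj_id T).
  have c3 := card_inj_mem co (@hinj i1).
  have c4 := card_inj_mem co (@hinj i2).
  move: c1 c2 c3 c4 (hW i1 j2) (hW i2 j1) sU rich; rewrite /= !size_map.
  move: #|_| #|_| #|_| #|_| #|_| #|_| #|_| (size _) #|_|; lia.
have [k] := @exists_avoid [:: (fun k => W i1 j2 k); (fun k => W i2 j1 k);
   (fun k => B i1 j2 k || B i2 j1 k); (fun k => k \in [:: l]); (fun k => k \in sy);
   (fun k => h k i1 \in co); (fun k => h k i2 \in co)] lt.
rewrite /= negb_or mem_seq1 => /and5P[w1 w2 /andP[b1 b2] kl /and4P[ks kh1 kh2 _]].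
have [i' [j' [k']]] := gd _ _ _ w1 b1.
move=> /and5P[n1 n2 n3 /[dup]g1/GL e1 /and3P[/[dup]g2/GL e2 /[dup]g3/GL e3 /[dup]g4/GL e4]].
have [i'' [j'' [k'']]] := gd _ _ _ w2 b2.
move=> /and5P[m1 m2 m3 /[dup]g5/GL e5 /and3P[/[dup]g6/GL e6 /[dup]g7/GL e7 /[dup]g8/GL e8]].
have j12 : j1 != j2.
  by apply: contraNneq ne => e; rewrite -(gL _ _ _ f1) e (gL _ _ _ f2).
(* The rows [i1], [i2], [i'], [i''] are pairwise distinct, so the two intercalates are disjoint. *)
have r1 : i' != i2 by apply: contraNneq kl => e; rewrite -e3 e f2.
have r2 : i'' != i1 by apply: contraNneq kl => e; rewrite -e7 e f1.
have r3 : i' != i''.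
  by apply: contraNneq j12 => e; rewrite -(hL _ _ _ e7) -e (hL _ _ _ e3).
have kU i j : (i, j, k) \notin U by apply: contraNN ks => /(map_f snd).
have jU i : (i, j', k') \notin U.
  by apply: contraNN kh1 => /(map_f (fun u => u.1.2)); rewrite (hL _ _ _ e2).
have jU' i : (i, j'', k'') \notin U.
  by apply: contraNN kh2 => /(map_f (fun u => u.1.2)); rewrite (hL _ _ _ e6).
exists ([:: (i1,j2,k'); (i1,j',k); (i',j2,k); (i',j',k')] ++
        [:: (i2,j1,k''); (i2,j'',k); (i'',j1,k); (i'',j'',k'')]); split=> //.
- rewrite /= !inE !xpair_eqE !negb_or !negb_and.
  rewrite ![_ == i1]eq_sym ?[_ == i2]eq_sym in r1 r2 r3 n1 m1 ne *.
  by rewrite ne n1 m1 r1 r2 r3 n2 m2 n3 m3 ![k' == k]eq_sym ![k'' == k]eq_sym n3 m3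
    ?[i'' == _]eq_sym ?r2 ?r1 ?r3 ?orbT.
- by rewrite /= /cells /= g1 g2 g3 g4 g5 g6 g7 g8.
- by rewrite /= !kU jU jU' -e1 -e5 U1 U2.
have := trade_cut (trade_oct i1 j2 l i2 j1 k) (trade_oct i1 j2 k i' j' k').
move=> /(trade_perm (R' := (i2, j1, k) :: [:: (i1, j1, l); (i2, j2, l)] ++
   [:: (i1,j2,k'); (i1,j',k); (i',j2,k); (i',j',k')])) tr.
apply: (trade_cut (tr _) (trade_oct i2 j1 k i'' j'' k'')).
exact: permEl (perm_catCA [:: (i1, j1, l); (i2, j2, l)] [:: (i2, j1, k)] _).
Qed.

Lemma rot3K t : rot3 (rot3 (rot3 t)) = t.
Proof. by case: t => [[i j] k]. Qed.

Lemma mem_rot3 t U : (t \in map rot3 U) = (rot3 (rot3 t) \in U).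
Proof. by rewrite -{1}[t]rot3K mem_map //; exact: rot3_inj. Qed.

(** This is [place_on_sym] for the rotated square. The list [U] is pulled back by the inverse
    rotation, which is [rot3] applied twice. *)
Lemma place_on_col f g h G W B U ia ka ib kb l :
  latin3 f g h -> (forall i j k, G i j k -> f i j = k) ->
  (forall i j k, ~~ W i j k -> ~~ B i j k -> good G i j k) ->
  (forall i k, 4 * #|[pred j | W i j k]| <= #|T|) ->
  h ka ia = l -> h kb ib = l -> ka != kb ->
  (ib, h ka ib, ka) \notin U -> (ia, h kb ia, kb) \notin U -> size U <= 60 ->
  2 * #|[pred j | B ib j ka || B ia j kb]| + 400 < #|T| ->
  exists R, [/\ uniq R, size R = 8, all (cells G) R, all (fun u => u \notin U) R
    & trade (ib, l, ka) [:: (ia, l, ka), (ib, l, kb) & R]].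
Proof.
move=> L GL gd hW f1 f2 ne U1 U2 sU rich.
have [|i j k /GL /eqP|i j k w b|i j||||R [uR sR GR UR tR]] :=
  @place_on_sym h f g (fun k i j => G i j k) (fun k i j => W i j k) (fun k i j => B i j k)
    (map rot3 (map rot3 U)) _ _ _ _ _ _ _ _ _ f1 f2 ne _ _ _ rich.
- exact/latin3_rot/latin3_rot.
- by rewrite (L _ _ _).2 => /eqP.
- exact: ((good_rot (fun j k i => G i j k) _ _ _).1 ((good_rot G j k i).1 (gd _ _ _ w b))).
- exact: hW.
- by rewrite !mem_rot3.
- by rewrite !mem_rot3.
- by rewrite !size_map.
exists (map rot3 R); split.
- by rewrite map_inj_uniq //; exact: rot3_inj.
- by rewrite size_map.
- by rewrite all_map.
- apply/allP => u /mapP[u' /(allP UR) + ->]; by rewrite !mem_rot3 rot3K.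
exact: trade_rot tR.
Qed.

Lemma place_on_row f g h G W B U ja ka jb kb l :
  latin3 f g h -> (forall i j k, G i j k -> f i j = k) ->
  (forall i j k, ~~ W i j k -> ~~ B i j k -> good G i j k) ->
  (forall j k, 4 * #|[pred i | W i j k]| <= #|T|) ->
  g ja ka = l -> g jb kb = l -> ja != jb ->
  (g ja kb, ja, kb) \notin U -> (g jb ka, jb, ka) \notin U -> size U <= 60 ->
  2 * #|[pred i | B i ja kb || B i jb ka]| + 400 < #|T| ->
  exists R, [/\ uniq R, size R = 8, all (cells G) R, all (fun u => u \notin U) R
    & trade (l, ja, kb) [:: (l, ja, ka), (l, jb, kb) & R]].
Proof.
move=> L GL gd hW f1 f2 ne U1 U2 sU rich.
have [|i j k /GL /eqP|i j k w b|i j||||R [uR sR GR UR tR]] :=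
  @place_on_col h f g (fun k i j => G i j k) (fun k i j => W i j k) (fun k i j => B i j k)
    (map rot3 (map rot3 U)) _ _ _ _ _ _ _ _ _ f1 f2 ne _ _ _ rich.
- exact/latin3_rot/latin3_rot.
- by rewrite (L _ _ _).2 => /eqP.
- exact: ((good_rot (fun j k i => G i j k) _ _ _).1 ((good_rot G j k i).1 (gd _ _ _ w b))).
- exact: hW.
- by rewrite !mem_rot3.
- by rewrite !mem_rot3.
- by rewrite !size_map.
exists (map rot3 R); split.
- by rewrite map_inj_uniq //; exact: rot3_inj.
- by rewrite size_map.
- by rewrite all_map.
- apply/allP => u /mapP[u' /(allP UR) + ->]; by rewrite !mem_rot3 rot3K.
exact: trade_rot tR.
Qed.

End Lines.

(** * Placing an arbitrary triple *)

Section Placement.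
Variable T : finType.
Implicit Types (i j k : T) (t u : T * T * T) (R U : seq (T * T * T)).
Implicit Types (G W B : T -> T -> T -> bool).

(** Three octahedra: the first leaves [(r, d, s)] and [(r', c, s)] to be inserted, the other two
    replace these by the four triples of the hypotheses. The definitions of [r1], [c1], [r'], [x],
    [y] make all other removed corners triples of the square. *)
Lemma trade_insert f g h r c s d ro ga R1 R2 R3 R4 :
  let r1 := g c s in let c1 := h s r in
  let r' := g d (f r c) in let x := f r d in let y := f r' c in
  trade (ro, d, s) [:: (ro, h s ro, s), (g d s, d, s) & R1] ->
  trade (ro, c1, x) [:: (g c1 x, c1, x), (ro, c1, f ro c1) & R2] ->
  trade (r', ga, s) [:: (r', h s r', s), (g ga s, ga, s) & R3] ->
  trade (r1, ga, y) [:: (r1, ga, f r1 ga), (r1, h y r1, y) & R4] ->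
  exists2 R, trade (r, c, s) R &
    perm_eq R ([:: (r, c, f r c); (r, c1, s); (r1, c, s); (r', d, f r c); (r, d, x);
                (g d s, d, s); (g c1 x, c1, x); (r', c, y); (r', h s r', s); (r1, h y r1, y);
                (ro, h s ro, s); (ro, c1, f ro c1); (g ga s, ga, s); (r1, ga, f r1 ga)]
                ++ R1 ++ R2 ++ R3 ++ R4).
Proof.
move=> r1 c1 r' x y S1 S2 S3 S4.
have H1 := trade_cut_at (A := [:: _; _; _]) (B := [::]) (trade_oct r d s ro c1 x) S2.
have {}H1 := trade_cut_at (A := [:: _; _]) H1 S1.
have H2 := trade_cut_at (A := [:: _; _; _]) (B := [::]) (trade_oct r' c s r1 ga y) S4.
have {}H2 := trade_cut_at (A := [:: _]) H2 S3.
have H0 := trade_cut_at (A := [:: _; _]) (B := [:: _]) (trade_oct r c s r' d (f r c)) H2.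
have {}H0 := trade_cut_at (A := [:: _]) H0 H1.
eexists; first exact: H0.
apply/permP => p; do 4! rewrite ?(count_cat, cats0) /=.
by repeat match goal with |- context [nat_of_bool ?b] => move: (nat_of_bool b) => ? end; lia.
Qed.

Section Lists.
Variables (f g h : T -> T -> T) (r c s d ro ga : T).
Let r1 := g c s.
Let c1 := h s r.
Let r' := g d (f r c).
Let x := f r d.
Let y := f r' c.

(* The triples of the square removed when [(r, c, s)] is inserted: those fixed by the choice of the
   column [d], then those that also depend on the row [ro] or on the column [ga]. The [_fixed]
   triples lie in the eight last intercalates, whatever their remaining parameter is. *)
Definition column_level := [:: (r, c, f r c); (r, c1, s); (r1, c, s); (r', d, f r c);
  (r, d, x); (g d s, d, s); (g c1 x, c1, x); (r', c, y); (r', h s r', s); (r1, h y r1, y)].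
Definition row_branch := [:: (ro, h s ro, s); (ro, c1, f ro c1)].
Definition col_branch := [:: (g ga s, ga, s); (r1, ga, f r1 ga)].
Definition row_fixed := [:: (ro, d, f ro d); (g d s, h s ro, f (g d s) (h s ro));
  (ro, h x ro, x); (g c1 x, h (f ro c1) (g c1 x), f ro c1)].
Definition col_fixed := [:: (r', ga, f r' ga); (g ga s, h s r', f (g ga s) (h s r'));
  (g ga y, ga, y); (g (h y r1) (f r1 ga), h y r1, f r1 ga)].
End Lists.

Lemma uniq_cat_avoid U R : uniq U -> uniq R -> all (fun u => u \notin U) R -> uniq (U ++ R).
Proof. by move=> uU uR a; rewrite cat_uniq uU uR andbT -all_predC. Qed.

Lemma avoidN U R u : all (fun u => u \notin U) R -> u \in U -> u \notin R.
Proof. by move=> /allP a uU; apply/negP => /a; rewrite uU. Qed.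

(** The four triples left by [trade_insert] are placed one after another. Each placement avoids [N],
    the results of the earlier ones and the fixed triples of the later ones, so that the later ones
    remain possible. In total 14 + 4 * 8 = 46 triples are removed. *)
Lemma place_triple f g h G W B r c s d ro ga :
  let r1 := g c s in let c1 := h s r in
  let r' := g d (f r c) in let x := f r d in let y := f r' c in
  let N := column_level f g h r c s d ++ row_branch f h r s ro ++ col_branch f g c s ga in
  latin3 f g h -> (forall i j k, G i j k -> f i j = k) ->
  (forall i j k, ~~ W i j k -> ~~ B i j k -> good G i j k) ->
  (forall i j, 4 * #|[pred k | W i j k]| <= #|T|) ->
  (forall i k, 4 * #|[pred j | W i j k]| <= #|T|) ->
  (forall j k, 4 * #|[pred i | W i j k]| <= #|T|) ->
  uniq (N ++ row_fixed f g h r s d ro ++ col_fixed f g h r c s d ga) ->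
  ro != g d s -> x != f ro c1 -> r' != g ga s -> ga != h y r1 ->
  2 * #|[pred k | B ro d k || B (g d s) (h s ro) k]| + 400 < #|T| ->
  2 * #|[pred j | B ro j x || B (g c1 x) j (f ro c1)]| + 400 < #|T| ->
  2 * #|[pred k | B r' ga k || B (g ga s) (h s r') k]| + 400 < #|T| ->
  2 * #|[pred i | B i ga y || B i (h y r1) (f r1 ga)]| + 400 < #|T| ->
  exists R, [/\ uniq R, size R = 46, trade (r, c, s) R
    & forall u, u \in R -> u \in N \/ cells G u].
Proof.
move=> r1 c1 r' x y N L GL gd hW1 hW2 hW3 uN n1 n2 n3 n4 b1 b2 b3 b4.
have gf := latin_gf L; have hf := latin_hf L; have fg := latin_fg L.
have fh := latin_fh L; have hg := latin_hg L; have gh := latin_gh L.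
have sN : size N = 14 by [].
move: uN; rewrite cat_uniq -all_predC => /and3P[uN /allP nF].
have {}nF u : u \in row_fixed f g h r s d ro ++ col_fixed f g h r c s d ga -> u \notin N.
  by move/nF.
have eN : N = column_level f g h r c s d ++ row_branch f h r s ro ++ col_branch f g c s ga by [].
clearbody N; move: nF; rewrite /row_fixed /col_fixed -/r1 -/c1 -/r' -/x -/y [_ ++ _]/=.
set p1 := (ro, d, _); set p2 := (g d s, _, _); set p3 := (ro, _, x).
set p4 := (g c1 x, _, _); set p5 := (r', ga, _); set p6 := (g ga s, _, _).
set p7 := (_, ga, y); set p8 := (_, h y r1, _).
move=> nF /and5P[q1 q2 q3 q4 /and4P[q5 q6 q7 _]].
have m1 : p1 \notin N by apply: nF; rewrite !inE eqxx ?orbT.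
have m2 : p2 \notin N by apply: nF; rewrite !inE eqxx ?orbT.
have m3 : p3 \notin N by apply: nF; rewrite !inE eqxx ?orbT.
have m4 : p4 \notin N by apply: nF; rewrite !inE eqxx ?orbT.
have m5 : p5 \notin N by apply: nF; rewrite !inE eqxx ?orbT.
have m6 : p6 \notin N by apply: nF; rewrite !inE eqxx ?orbT.
have m7 : p7 \notin N by apply: nF; rewrite !inE eqxx ?orbT.
have m8 : p8 \notin N by apply: nF; rewrite !inE eqxx ?orbT.
have tl (p q : T * T * T) U : p \notin q :: U -> p \notin U.
  by rewrite inE negb_or => /andP[].
have aN (p : T * T * T) F U R : all (fun u => u \notin N ++ U ++ F) R -> p \in F -> p \notin R.
  by move=> /avoidN aR pF; apply: aR; rewrite !mem_cat pF !orbT.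
have pU (p : T * T * T) U F : p \notin N -> p \notin U -> p \notin F -> p \notin N ++ U ++ F.
  by move=> pN' pU pF; rewrite !mem_cat !negb_or pN' pU.
(* Besides the 14 triples of [N] there are at most three earlier lists of 8 and at most 6 reserved
   fixed triples: 44 in all. *)
have sz (U F : seq (T * T * T)) : size U <= 24 -> size F <= 6 -> size (N ++ U ++ F) <= 60.
  by move=> sU sF; rewrite !size_cat sN; exact: (@leq_trans (14 + (24 + 6))) (leq_add (leqnn 14) (leq_add sU sF)) _.
have catN (p : T * T * T) (U V : seq (T * T * T)) : p \notin U -> p \notin V -> p \notin U ++ V.
  by rewrite mem_cat negb_or => -> ->.
have [R1 [uR1 sR1 GR1 aR1 t1]] := @place_on_sym T f g h G W B
  (N ++ [::] ++ [:: p3; p4; p5; p6; p7; p8]) ro (h s ro) (g d s) d s L GL gd hW1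
  (fh _ _) (fg _ _) n1 (pU p1 [::] _ m1 isT (tl _ _ _ q1)) (pU p2 [::] _ m2 isT q2)
  (sz [::] [:: p3; p4; p5; p6; p7; p8] isT isT) b1.
have p3R1 : p3 \notin R1 by apply: (aN) aR1 _; rewrite !inE eqxx ?orbT.
have p4R1 : p4 \notin R1 by apply: (aN) aR1 _; rewrite !inE eqxx ?orbT.
have p5R1 : p5 \notin R1 by apply: (aN) aR1 _; rewrite !inE eqxx ?orbT.
have p6R1 : p6 \notin R1 by apply: (aN) aR1 _; rewrite !inE eqxx ?orbT.
have p7R1 : p7 \notin R1 by apply: (aN) aR1 _; rewrite !inE eqxx ?orbT.
have p8R1 : p8 \notin R1 by apply: (aN) aR1 _; rewrite !inE eqxx ?orbT.
have sR1' : size R1 <= 24 by rewrite sR1.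
have [R2 [uR2 sR2 GR2 aR2 t2]] := @place_on_col T f g h G W B
  (N ++ R1 ++ [:: p5; p6; p7; p8]) (g c1 x) x ro (f ro c1) c1 L GL gd hW2
  (hg _ _) (hf _ _) n2 (pU p3 R1 _ m3 p3R1 (tl _ _ _ q3)) (pU p4 R1 _ m4 p4R1 q4)
  (sz R1 [:: p5; p6; p7; p8] sR1' isT) b2.
have p5R2 : p5 \notin R2 by apply: (aN) aR2 _; rewrite !inE eqxx ?orbT.
have p6R2 : p6 \notin R2 by apply: (aN) aR2 _; rewrite !inE eqxx ?orbT.
have p7R2 : p7 \notin R2 by apply: (aN) aR2 _; rewrite !inE eqxx ?orbT.
have p8R2 : p8 \notin R2 by apply: (aN) aR2 _; rewrite !inE eqxx ?orbT.
have sR2' : size (R1 ++ R2) <= 24 by rewrite size_cat sR1 sR2.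
have [R3 [uR3 sR3 GR3 aR3 t3]] := @place_on_sym T f g h G W B
  (N ++ (R1 ++ R2) ++ [:: p7; p8]) r' (h s r') (g ga s) ga s L GL gd hW1
  (fh _ _) (fg _ _) n3 (pU p5 (R1 ++ R2) _ m5 (catN _ _ _ p5R1 p5R2) (tl _ _ _ q5))
  (pU p6 (R1 ++ R2) _ m6 (catN _ _ _ p6R1 p6R2) q6)
  (sz (R1 ++ R2) [:: p7; p8] sR2' isT) b3.
have p7R3 : p7 \notin R3 by apply: (aN) aR3 _; rewrite !inE eqxx ?orbT.
have p8R3 : p8 \notin R3 by apply: (aN) aR3 _; rewrite !inE eqxx ?orbT.
have sR3' : size (R1 ++ R2 ++ R3) <= 24 by rewrite !size_cat sR1 sR2 sR3.
have [R4 [uR4 sR4 GR4 aR4 t4]] := @place_on_row T f g h G W B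
  (N ++ (R1 ++ R2 ++ R3) ++ [::]) ga (f r1 ga) (h y r1) y r1 L GL gd hW3
  (gf _ _) (gh _ _) n4
  (pU p7 (R1 ++ R2 ++ R3) [::] m7 (catN _ _ _ p7R1 (catN _ _ _ p7R2 p7R3)) isT)
  (pU p8 (R1 ++ R2 ++ R3) [::] m8 (catN _ _ _ p8R1 (catN _ _ _ p8R2 p8R3)) isT)
  (sz (R1 ++ R2 ++ R3) [::] sR3' isT) b4.
have [R tR pR] := trade_insert t1 t2 t3 t4.
have {}pR : perm_eq R (N ++ R1 ++ R2 ++ R3 ++ R4) by rewrite eN.
have drop_ (U F V : seq (T * T * T)) : all (fun u => u \notin N ++ U ++ F) V ->
    all (fun u => u \notin N ++ U) V.
  by apply: sub_all => u; apply: contraNN; rewrite !mem_cat; case/orP=> ->; rewrite ?orbT.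
exists R; split=> //.
- rewrite (perm_uniq pR) !catA; do 4?[apply: uniq_cat_avoid => //].
  + by have := drop_ _ _ _ aR1; rewrite cats0.
  + exact: drop_ aR2.
  + by rewrite -catA; exact: drop_ aR3.
  by have := drop_ _ _ _ aR4; rewrite !catA.
- by rewrite (perm_size pR) !size_cat sN sR1 sR2 sR3 sR4.
move=> u; rewrite (perm_mem pR) !mem_cat; case/orP => [|uG]; first by left.
by right; case/or4P: uG; apply/allP.
Qed.

End Placement.

(** * Distinctness of the removed triples *)

Section Distinct.
Variable T : finType.
Implicit Types (i j k : T) (t u : T * T * T) (R U : seq (T * T * T)).

Definition rows U : seq T := [seq u.1.1 | u <- U].
Definition cols U : seq T := [seq u.1.2 | u <- U].
Definition syms U : seq T := [seq u.2 | u <- U].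

Lemma row_avoid U i j k : i \notin rows U -> (i, j, k) \notin U.
Proof. by apply: contraNN => /(map_f (fun u => u.1.1)). Qed.

Lemma col_avoid U i j k : j \notin cols U -> (i, j, k) \notin U.
Proof. by apply: contraNN => /(map_f (fun u => u.1.2)). Qed.

Lemma sym_avoid U i j k : k \notin syms U -> (i, j, k) \notin U.
Proof. by apply: contraNN => /(map_f snd). Qed.

Variables (f g h : T -> T -> T) (r c s d ro ga : T).
Hypothesis L : latin3 f g h.
Let r1 := g c s.
Let c1 := h s r.
Let r' := g d (f r c).
Let x := f r d.
Let y := f r' c.
Let CL := column_level f g h r c s d.
Let RL := row_branch f h r s ro ++ row_fixed f g h r s d ro.
Let GL := col_branch f g c s ga ++ col_fixed f g h r c s d ga.

Let gf := latin_gf L.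
Let hf := latin_hf L.
Let fg := latin_fg L.
Let fh := latin_fh L.
Let hg := latin_hg L.
Let gh := latin_gh L.

Hypothesis rcs : f r c != s.
Hypotheses (dc : d != c) (dc1 : d != c1) (rr1 : r' != r1) (qr1 : g c1 x != r1).

(** Beyond the four conditions on [d], every inequality needed follows from [f r c != s] by
    cancellation. *)
Lemma uniq_column_level : uniq CL.
Proof.
have cc1 : c != c1 by apply: contraNneq rcs => ->; rewrite fh.
have r_r' : r != r' by apply: contraNneq dc => e; rewrite -(hf r c) {2}e hg.
have r_r1 : r != r1 by apply: contraNneq rcs => e; rewrite e /r1 fg.
have xs : x != s by apply: contraNneq dc1 => e; rewrite /c1 -e hf.
have ys : y != s by apply: contraNneq rr1 => e; rewrite /r1 -e gf.
have pr' : g d s != r' by apply: contraNneq rcs => e; rewrite -(fg d (f r c)) -/r' -e fg.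
have pr1 : g d s != r1 by apply: contraNneq dc => e; rewrite -(hg d s) e hg.
have E (a b : T) : a != b -> ((a == b) = false) * ((b == a) = false).
  by move=> ab; rewrite [b == a]eq_sym (negPf ab).
rewrite /CL /column_level -/r1 -/c1 -/r' -/x -/y /= !inE !xpair_eqE !negb_or.
by rewrite !(E _ _ cc1, E _ _ r_r', E _ _ r_r1, E _ _ xs, E _ _ ys, E _ _ pr', E _ _ pr1,
  E _ _ rcs, E _ _ dc, E _ _ dc1, E _ _ rr1, E _ _ qr1) /= ?andbF.
Qed.

Hypotheses (ro_new : ro \notin rows CL) (ro_col_new : h s ro \notin cols CL)
  (ro_sym_new : f ro c1 \notin syms CL).
Hypothesis row_pair :
  (g d s, h s ro, f (g d s) (h s ro)) != (g c1 x, h (f ro c1) (g c1 x), f ro c1).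

Let ne_in (a b : T) (S : seq T) : a \notin S -> b \in S -> a != b.
Proof. by move=> aS bS; apply: contraNneq aS => ->. Qed.

(** Each triple of [RL] has the row [ro], the column [h s ro] or the symbol [f ro c1], none of which
    occurs in [CL]. Within [RL], only the coincidence excluded by [row_pair] is not ruled out by
    newness and cancellation. *)
Lemma uniq_row_level : uniq (CL ++ RL).
Proof.
apply: uniq_cat_avoid uniq_column_level _ _; last first.
  by rewrite /= !(row_avoid _ _ ro_new) (col_avoid _ _ ro_col_new) (sym_avoid _ _ ro_sym_new).
have rp : ro != g d s by apply: ne_in ro_new _; rewrite /= !inE eqxx ?orbT.
have rq : ro != g c1 x by apply: ne_in ro_new _; rewrite /= !inE eqxx ?orbT.
have ror : ro != r by apply: ne_in ro_new _; rewrite /= !inE eqxx ?orbT.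
have sc1 : h s ro != c1 by apply: ne_in ro_col_new _; rewrite /= !inE eqxx ?orbT.
have sd : h s ro != d by apply: ne_in ro_col_new _; rewrite /= !inE eqxx ?orbT.
have zx : f ro c1 != x by apply: ne_in ro_sym_new _; rewrite /= !inE eqxx ?orbT.
have xs : x != s by apply: contraNneq dc1 => e; rewrite /c1 -e hf.
have fx : f ro d != x by apply: contraNneq ror => e; rewrite -(gf ro d) e gf.
have E (a b : T) : a != b -> ((a == b) = false) * ((b == a) = false).
  by move=> ab; rewrite [b == a]eq_sym (negPf ab).
move: row_pair; rewrite /RL /= !inE !xpair_eqE -/c1 -/x !negb_or.
set b := ~~ _ => ->.
by rewrite !(E _ _ rp, E _ _ rq, E _ _ sc1, E _ _ sd, E _ _ zx, E _ _ xs, E _ _ fx,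
  E _ _ dc1) /= ?andbF.
Qed.

Hypotheses (ga_new : ga \notin cols (CL ++ RL)) (ga_row_new : g ga s \notin rows (CL ++ RL))
  (ga_sym_new : f r1 ga \notin syms (CL ++ RL)).
Hypothesis col_pair : (g ga s, h s r', f (g ga s) (h s r')) !=
  (g (h y r1) (f r1 ga), h y r1, f r1 ga).

Lemma uniq_col_level : uniq ((CL ++ RL) ++ GL).
Proof.
apply: uniq_cat_avoid uniq_row_level _ _; last first.
  by rewrite /= !(col_avoid _ _ ga_new) (row_avoid _ _ ga_row_new) (sym_avoid _ _ ga_sym_new).
have a1 : g ga s != r1 by apply: ne_in ga_row_new _; rewrite /= !inE eqxx ?orbT.
have a2 : g ga s != r' by apply: ne_in ga_row_new _; rewrite /= !inE eqxx ?orbT.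
have a3 : ga != h s r' by apply: ne_in ga_new _; rewrite /= !inE eqxx ?orbT.
have a4 : ga != h y r1 by apply: ne_in ga_new _; rewrite /= !inE eqxx ?orbT.
have a5 : ga != c by apply: ne_in ga_new _; rewrite /= !inE eqxx ?orbT.
have a6 : f r1 ga != y by apply: ne_in ga_sym_new _; rewrite /= !inE eqxx ?orbT.
have ys : y != s by apply: contraNneq rr1 => e; rewrite /r1 -e gf.
have fy : f r' ga != y by apply: contraNneq a5 => e; rewrite -(hf r' ga) e hf.
have E (a b : T) : a != b -> ((a == b) = false) * ((b == a) = false).
  by move=> ab; rewrite [b == a]eq_sym (negPf ab).
move: col_pair; rewrite /GL /= !inE !xpair_eqE -/r1 -/r' -/y !negb_or.
set b := ~~ _ => ->.
by rewrite !(E _ _ a1, E _ _ a2, E _ _ a3, E _ _ a4, E _ _ a6, E _ _ ys, E _ _ fy,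
  E _ _ rr1) /= ?andbF.
Qed.

Lemma levels_distinct : [/\ ro != g d s, x != f ro c1, r' != g ga s & ga != h y r1].
Proof.
rewrite ![x == _]eq_sym ![r' == _]eq_sym.
by split; [apply: ne_in ro_new _ | apply: ne_in ro_sym_new _ | apply: ne_in ga_row_new _
  | apply: ne_in ga_new _]; rewrite /= !inE eqxx ?orbT.
Qed.

Lemma uniq_levels : uniq ((CL ++ row_branch f h r s ro ++ col_branch f g c s ga) ++
  row_fixed f g h r s d ro ++ col_fixed f g h r c s d ga).
Proof.
move: uniq_col_level; rewrite /RL /GL; congr (is_true _); apply: perm_uniq.
rewrite -!catA !perm_cat2l; exact: permEl (perm_catCA _ _ _).
Qed.

End Distinct.

(** * Counting admissible parameters *)

Lemma card_pairs (S S' : finType) (P : S -> S' -> bool) :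
  \sum_p #|[pred k | P p k]| = #|[pred t : S * S' | P t.1 t.2]|.
Proof.
transitivity (\sum_p \sum_k if P p k then 1 else 0).
  by apply: eq_bigr => p _; rewrite -sum1_card big_mkcond.
by rewrite pair_bigA -sum1_card [RHS]big_mkcond.
Qed.

Lemma markov_card (S : finType) (F : S -> nat) m :
  m * #|[pred p | m <= F p]| <= \sum_p F p.
Proof.
rewrite mulnC -sum_nat_const [leqRHS](bigID [pred p | m <= F p]) /=.
by apply: leq_trans (leq_addr _ _); apply: leq_sum => p.
Qed.

Lemma card_preim_inj (S S' : finType) (phi : S -> S') (P : pred S') : injective phi ->
  #|[pred x | P (phi x)]| <= #|P|.
Proof.
move=> inj; rewrite -(card_image inj); apply: subset_leq_card.
by apply/subsetP => y /imageP[x]; rewrite !inE => Px ->.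
Qed.

Lemma card_predU_le (S : finType) (P Q : pred S) :
  #|[pred x | P x || Q x]| <= #|[pred x | P x]| + #|[pred x | Q x]|.
Proof.
rewrite -cardUI; apply: leq_trans (leq_addr _ _).
by apply: subset_leq_card; apply/subsetP => x; rewrite !inE.
Qed.

(* Constants are written as products since [lia] does not evaluate numerals above 5000. *)
Lemma poor_arith (b m a : nat) : 25 * 1000 < m -> 30 * b <= m ^ 3 -> (m - 400) * a <= 4 * b ->
  7 * a <= m ^ 2.
Proof.
rewrite !expnS expn0 muln1 => m0 hb ha.
have [k mk] : exists k, m = k + 400 by exists (m - 400); lia.
rewrite leqNgt; apply/negP => lt.
have : (m - 400) * (m * m) < (m - 400) * (7 * a) by rewrite ltn_mul2l lt andbT; lia.
have mk' : m - 400 = k by rewrite mk addnK.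
rewrite mk' in ha *; set q := m * m in hb *; set kq := k * q; set ka := k * a in ha *.
have -> : k * (7 * a) = 7 * ka by rewrite mulnCA.
rewrite mulnC -/q -?[m * _]/q in hb *; move=> h1.
have : (30 * k) * q < (28 * m) * q.
  have -> : 30 * k * q = 30 * kq by rewrite -mulnA.
  have -> : 28 * m * q = 28 * (m * (m * m)) by rewrite -mulnA.
  lia.
by rewrite ltn_mul2r => /andP[_]; lia.
Qed.

(** The right-hand side is at most 2/7 of [m ^ 2] plus [m], and the gap between 2/7 and 2/5 absorbs
    the lower-order terms. The bound 2/5 lets two such exclusions leave a fifth of all
    parameters. *)
Lemma fail_arith (m e z X a a' a'' : nat) : 25 * 1000 < m -> 6 * 1000 * e <= m -> z <= 60 ->
  7 * a <= m ^ 2 -> 7 * a' <= m ^ 2 -> a'' <= m ->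
  (m - (z + 2 * e)) * X <= a + a' + a'' -> 5 * X <= 2 * m.
Proof.
rewrite !expnS expn0 muln1 => m0 me z0 ha ha' ha'' hX.
rewrite leqNgt; apply/negP => lt.
have [k mk] : exists k, m = k + (z + 2 * e) by exists (m - (z + 2 * e)); lia.
have : k * (2 * m) <= k * (5 * X) by rewrite leq_mul2l ltnW ?orbT.
have h : 5 * m + 20 <= 7 * k by lia.
have : (5 * m + 20) * m <= 7 * k * m by rewrite leq_mul2r h orbT.
rewrite [in X in X - _]mk addnK in hX; nia.
Qed.

Section Counting.
Variable T : finType.
Let n := #|T|.

(** Double counting: [phi] and [psi] each hit a triple of [B] at most once, and being poor means
    losing about half of a line. How [B] is spread over the lines does not matter. *)
Lemma poor_pairs (B : pred (T * T * T)) (phi psi : T * T * T -> T * T * T) :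
  injective phi -> injective psi ->
  (n - 400) * #|[pred p : T * T |
    n <= 2 * #|[pred k | B (phi (p, k)) || B (psi (p, k))]| + 400]| <= 4 * #|B|.
Proof.
move=> iphi ipsi.
pose F (p : T * T) := 2 * #|[pred k | B (phi (p, k)) || B (psi (p, k))]|.
rewrite (eq_card (B := [pred p | n - 400 <= F p])); last first.
  by move=> p; rewrite !inE /F leq_subLR addnC.
apply: leq_trans (markov_card F _) _; rewrite /F -big_distrr /=.
rewrite (card_pairs (fun p k => B (phi (p, k)) || B (psi (p, k)))).
rewrite (eq_card (B := [pred t | B (phi t) || B (psi t)])); last by case.
have := card_predU_le (fun t => B (phi t)) (fun t => B (psi t)).
have := card_preim_inj B iphi; have := card_preim_inj B ipsi.
by move: #|_| #|_| #|_| #|_|; lia.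
Qed.

Lemma card_line (S : {set T * T * T}) (phi : T -> T * T * T) (p : T * T * T -> T) l :
  injective phi -> (forall x, p (phi x) = l) ->
  #|[pred x | phi x \in S]| <= #|[set u in S | p u == l]|.
Proof.
move=> iphi pl; apply: leq_trans (card_preim_inj (mem [set u in S | p u == l]) iphi).
by apply: subset_leq_card; apply/subsetP => x; rewrite !inE pl eqxx andbT.
Qed.

End Counting.

(** * Choosing the parameters [d], [ro] and [ga] *)

Section Step.
Variable T : finType.
Let n := #|T|.
Hypothesis n_big : 25 * 1000 < n.

(** Markov's inequality: for all but 2/5 of the [d], more than [z + 2 * e] values of [i] survive the
    three exclusions. *)
Lemma few_fail (P P' Q : T -> T -> bool) z e : 6 * 1000 * e <= n -> z <= 60 ->
  7 * #|[pred p : T * T | P p.1 p.2]| <= n ^ 2 ->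
  7 * #|[pred p : T * T | P' p.1 p.2]| <= n ^ 2 ->
  #|[pred p : T * T | Q p.1 p.2]| <= n ->
  5 * #|[pred d | n <= #|[pred i | P d i || (P' d i || Q d i)]| + (z + 2 * e)]| <= 2 * n.
Proof.
move=> he hz hP hP' hQ; apply: fail_arith n_big he hz hP hP' hQ _.
pose F d := #|[pred i | P d i || (P' d i || Q d i)]|.
rewrite (eq_card (B := [pred d | n - (z + 2 * e) <= F d])); last first.
  by move=> d; rewrite !inE /F leq_subLR addnC.
apply: leq_trans (markov_card F _) _.
rewrite /F (card_pairs (fun d i => P d i || (P' d i || Q d i))) -addnA.
apply: leq_trans (card_predU_le _ _) _; rewrite leq_add2l.
exact: card_predU_le.
Qed.

Variables (f g h : T -> T -> T) (G W B : T -> T -> T -> bool) (Pr : {set T * T * T}).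
Variables (r c s : T) (e : nat).
Hypothesis L : latin3 f g h.
Let r1 := g c s.
Let c1 := h s r.
Let r' d := g d (f r c).
Let x d := f r d.
Let y d := f (r' d) c.

Let gf := latin_gf L.
Let hf := latin_hf L.
Let fg := latin_fg L.
Let fh := latin_fh L.
Let hg := latin_hg L.
Let gh := latin_gh L.
Let f1I j : injective (f^~ j). Proof. exact: (can_inj (g := g j) (fun z => gf z j)). Qed.
Let f2I i : injective (f i). Proof. exact: (can_inj (g := fun z => h z i) (hf i)). Qed.
Let g1I k : injective (g^~ k). Proof. exact: (can_inj (g := h k) (fun z => hg z k)). Qed.
Let g2I j : injective (g j). Proof. exact: (can_inj (g := fun z => f z j) (fg j)). Qed.
Let h1I i : injective (h^~ i). Proof. exact: (can_inj (g := f i) (fun z => fh z i)). Qed.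
Let h2I k : injective (h k). Proof. exact: (can_inj (g := fun z => g z k) (gh k)). Qed.
Let r'I : injective r'. Proof. exact: g1I. Qed.
Let xI : injective x. Proof. exact: f2I. Qed.
Let yI : injective y. Proof. exact: inj_comp (@f1I c) r'I. Qed.

Hypothesis e_small : 6 * 1000 * e <= n.
Hypothesis B_small : 30 * #|cells B| <= n ^ 3.

(** The ways in which [ro] can fail for a given [d]: too many bad triples for one of the two
    placements involving [ro], or the coincidence forbidden by [row_pair]. *)
Definition row_poor d ro :=
  (n <= 2 * #|[pred k | B ro d k || B (g d s) (h s ro) k]| + 400) ||
  ((n <= 2 * #|[pred j | B ro j (x d) || B (g c1 (x d)) j (f ro c1)]| + 400) ||
   ((g d s, h s ro, f (g d s) (h s ro)) ==
    (g c1 (x d), h (f ro c1) (g c1 (x d)), f ro c1))).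

Definition col_poor d ga :=
  (n <= 2 * #|[pred k | B (r' d) ga k || B (g ga s) (h s (r' d)) k]| + 400) ||
  ((n <= 2 * #|[pred i | B i ga (y d) || B i (h (y d) r1) (f r1 ga)]| + 400) ||
   ((g ga s, h s (r' d), f (g ga s) (h s (r' d))) ==
    (g (h (y d) r1) (f r1 ga), h (y d) r1, f r1 ga))).

Let poor (phi psi : T * T * T -> T * T * T) : injective phi -> injective psi ->
  7 * #|[pred p : T * T |
    n <= 2 * #|[pred k | cells B (phi (p, k)) || cells B (psi (p, k))]| + 400]| <= n ^ 2.
Proof.
move=> iphi ipsi; apply: poor_arith n_big B_small _.
exact: poor_pairs.
Qed.

(** Each of the four families of triples occurring in [row_poor] depends injectively on [d], [ro]
    and the last parameter, so [poor_pairs] applies to both placements. *)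
Lemma row_fail z : z <= 60 ->
  5 * #|[pred d | n <= #|[pred ro | row_poor d ro]| + (z + 2 * e)]| <= 2 * n.
Proof.
move=> hz; apply: few_fail e_small hz _ _ _.
- apply: (@poor (fun t => (t.1.2, t.1.1, t.2)) (fun t => (g t.1.1 s, h s t.1.2, t.2))).
    by move=> [[? ?] ?] [[? ?] ?] [-> -> ->].
  by move=> [[? ?] ?] [[? ?] ?] [/g1I-> /h2I-> ->].
- apply: (@poor (fun t => (t.1.2, t.2, x t.1.1))
                (fun t => (g c1 (x t.1.1), t.2, f t.1.2 c1))).
    by move=> [[? ?] ?] [[? ?] ?] [-> -> /xI->].
  by move=> [[? ?] ?] [[? ?] ?] [/g2I/xI-> -> /f1I->].
(* In a coincidence, [ro] fixes the column [h s ro] and the symbol [f ro c1], hence the row [g d s],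
   hence [d]: at most one [d] for each [ro]. *)
set S := [pred p | _]; have I : {in S &, injective snd}.
  move=> [d ro] [d' ro'] /= /eqP[a b k] /eqP[a' b' k'] ee; rewrite -{}ee in a' b' k' *.
  congr (_, _); apply: (@g1I s).
  by rewrite -[LHS](gf _ (h s ro)) -[RHS](gf _ (h s ro)) k k'.
by rewrite -(card_in_image I); exact: max_card.
Qed.

Lemma col_fail z : z <= 60 ->
  5 * #|[pred d | n <= #|[pred ga | col_poor d ga]| + (z + 2 * e)]| <= 2 * n.
Proof.
move=> hz; apply: few_fail e_small hz _ _ _.
- apply: (@poor (fun t => (r' t.1.1, t.1.2, t.2))
                (fun t => (g t.1.2 s, h s (r' t.1.1), t.2))).
    by move=> [[? ?] ?] [[? ?] ?] [/r'I-> -> ->].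
  by move=> [[? ?] ?] [[? ?] ?] [/g1I-> /h2I/r'I-> ->].
- apply: (@poor (fun t => (t.2, t.1.2, y t.1.1))
                (fun t => (t.2, h (y t.1.1) r1, f r1 t.1.2))).
    by move=> [[? ?] ?] [[? ?] ?] [-> -> /yI->].
  by move=> [[? ?] ?] [[? ?] ?] [-> /h1I/yI-> /f2I->].
set S := [pred p | _]; have I : {in S &, injective snd}.
  move=> [d ga] [d' ga'] /= /eqP[a b k] /eqP[a' b' k'] ee; rewrite -{}ee in a' b' k' *.
  congr (_, _); apply: r'I; apply: (@h2I s); apply: (@f2I (g ga s)).
  by rewrite k k'.
by rewrite -(card_in_image I); exact: max_card.
Qed.

Hypothesis G_sub : forall i j k, G i j k -> f i j = k.
Hypothesis G_avoid : forall i j k, G i j k -> (i, j, k) \notin Pr.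
Hypothesis G_good : forall i j k, ~~ W i j k -> ~~ B i j k -> good G i j k.
Hypothesis W_sym : forall i j, 4 * #|[pred k | W i j k]| <= n.
Hypothesis W_col : forall i k, 4 * #|[pred j | W i j k]| <= n.
Hypothesis W_row : forall j k, 4 * #|[pred i | W i j k]| <= n.
Hypothesis Pr_row : forall i, #|[set u in Pr | u.1.1 == i]| <= e.
Hypothesis Pr_col : forall j, #|[set u in Pr | u.1.2 == j]| <= e.
Hypothesis Pr_sym : forall k, #|[set u in Pr | u.2 == k]| <= e.
Hypothesis rcs : f r c != s.
Hypotheses (Pr1 : (r, c, f r c) \notin Pr) (Pr2 : (r, c1, s) \notin Pr)
  (Pr3 : (r1, c, s) \notin Pr).

Let line_row (phi : T -> T * T * T) i : injective phi -> (forall z, (phi z).1.1 = i) ->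
  #|[pred z | phi z \in Pr]| <= e.
Proof. by move=> I H; apply: leq_trans (card_line (p := fun u => u.1.1) Pr I H) _. Qed.

Let line_col (phi : T -> T * T * T) j : injective phi -> (forall z, (phi z).1.2 = j) ->
  #|[pred z | phi z \in Pr]| <= e.
Proof. by move=> I H; apply: leq_trans (card_line (p := fun u => u.1.2) Pr I H) _. Qed.

Let line_sym (phi : T -> T * T * T) k : injective phi -> (forall z, (phi z).2 = k) ->
  #|[pred z | phi z \in Pr]| <= e.
Proof. by move=> I H; apply: leq_trans (card_line (p := snd) Pr I H) _. Qed.

(** The reserves anticipate the next two choices: 30 and 48 are the rows, columns and symbols of 10
    and of 16 earlier triples, and [2 * e] pays for keeping two further triples out of [Pr]. *)
Lemma choose_column : exists d,
  [/\ [&& d != c, d != c1, r' d != r1 & g c1 (x d) != r1],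
      all (fun u => u \notin Pr) (column_level f g h r c s d),
      #|[pred ro | row_poor d ro]| + (30 + 2 * e) < n
    & #|[pred ga | col_poor d ga]| + (48 + 2 * e) < n].
Proof.
have k1 := card_inj_mem [:: c; c1] (@inj_id T).
have k2 := card_inj_mem [:: r1] r'I.
have k3 := card_inj_mem [:: r1] (inj_comp (@g2I c1) xI).
have k4 : #|[pred d | (r' d, d, f r c) \in Pr]| <= e.
  by apply: (@line_sym (fun d => (r' d, d, f r c)) (f r c)) => // ? ? [].
have k5 : #|[pred d | (r, d, x d) \in Pr]| <= e.
  by apply: (@line_row (fun d => (r, d, x d)) r) => // ? ? [].
have k6 : #|[pred d | (g d s, d, s) \in Pr]| <= e.
  by apply: (@line_sym (fun d => (g d s, d, s)) s) => // ? ? [].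
have k7 : #|[pred d | (g c1 (x d), c1, x d) \in Pr]| <= e.
  by apply: (@line_col (fun d => (g c1 (x d), c1, x d)) c1) => // ? ? [_ /xI].
have k8 : #|[pred d | (r' d, c, y d) \in Pr]| <= e.
  by apply: (@line_col (fun d => (r' d, c, y d)) c) => // ? ? [/r'I].
have k9 : #|[pred d | (r' d, h s (r' d), s) \in Pr]| <= e.
  by apply: (@line_sym (fun d => (r' d, h s (r' d), s)) s) => // ? ? [/r'I].
have k10 : #|[pred d | (r1, h (y d) r1, y d) \in Pr]| <= e.
  by apply: (@line_row (fun d => (r1, h (y d) r1, y d)) r1) => // ? ? [_ /yI].
have k11 := @row_fail 30 isT.
have k12 := @col_fail 48 isT.
(* In total at most 4 values for distinctness, [7 * e] for avoiding [Pr], and twice 2/5 of all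
   values for [row_fail] and [col_fail]. *)
have lt : #|[pred d | d \in [:: c; c1]]| + (#|[pred d | r' d \in [:: r1]]| +
  (#|[pred d | g c1 (x d) \in [:: r1]]| + (#|[pred d | (r' d, d, f r c) \in Pr]| +
  (#|[pred d | (r, d, x d) \in Pr]| + (#|[pred d | (g d s, d, s) \in Pr]| +
  (#|[pred d | (g c1 (x d), c1, x d) \in Pr]| + (#|[pred d | (r' d, c, y d) \in Pr]| +
  (#|[pred d | (r' d, h s (r' d), s) \in Pr]| +
  (#|[pred d | (r1, h (y d) r1, y d) \in Pr]| +
  (#|[pred d | n <= #|[pred ro | row_poor d ro]| + (30 + 2 * e)]| +
  (#|[pred d | n <= #|[pred ga | col_poor d ga]| + (48 + 2 * e)]| + 0))))))))))) < n.
  move: n_big e_small k1 k2 k3 k4 k5 k6 k7 k8 k9 k10 k11 k12; rewrite /=.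
  move: #|_| #|_| #|_| #|_| #|_| #|_| #|_| #|_| #|_| #|_| #|_| #|_|.
  by clear; move: n e; lia.
have [d] := @exists_avoid T [:: (fun d => d \in [:: c; c1]); (fun d => r' d \in [:: r1]);
  (fun d => g c1 (x d) \in [:: r1]); (fun d => (r' d, d, f r c) \in Pr);
  (fun d => (r, d, x d) \in Pr); (fun d => (g d s, d, s) \in Pr);
  (fun d => (g c1 (x d), c1, x d) \in Pr); (fun d => (r' d, c, y d) \in Pr);
  (fun d => (r' d, h s (r' d), s) \in Pr); (fun d => (r1, h (y d) r1, y d) \in Pr);
  (fun d => n <= #|[pred ro | row_poor d ro]| + (30 + 2 * e));
  (fun d => n <= #|[pred ga | col_poor d ga]| + (48 + 2 * e))] lt.
rewrite /= !inE negb_or -!ltnNge.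
move=> /and5P[/andP[a1 a2] a3 a4 b1 /and5P[b2 b3 b4 b5 /and5P[b6 b7 f1 f2 _]]].
exists d; split=> //; first by rewrite a1 a2 a3 a4.
by rewrite /= Pr1 Pr2 Pr3 b1 b2 b3 b4 b5 b6 b7.
Qed.

Lemma choose_row CL d : size CL = 10 -> #|[pred ro | row_poor d ro]| + (30 + 2 * e) < n ->
  exists ro, [/\ ~~ row_poor d ro, [&& ro \notin rows CL, h s ro \notin cols CL
    & f ro c1 \notin syms CL] & all (fun u => u \notin Pr) (row_branch f h r s ro)].
Proof.
move=> sCL k0.
have k1 := card_inj_mem (rows CL) (@inj_id T).
have k2 := card_inj_mem (cols CL) (@h2I s).
have k3 := card_inj_mem (syms CL) (@f1I c1).
have k4 : #|[pred ro | (ro, h s ro, s) \in Pr]| <= e.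
  by apply: (@line_sym (fun ro => (ro, h s ro, s)) s) => // ? ? [].
have k5 : #|[pred ro | (ro, c1, f ro c1) \in Pr]| <= e.
  by apply: (@line_col (fun ro => (ro, c1, f ro c1)) c1) => // ? ? [].
have lt : #|[pred ro | row_poor d ro]| + (#|[pred ro | ro \in rows CL]| +
  (#|[pred ro | h s ro \in cols CL]| + (#|[pred ro | f ro c1 \in syms CL]| +
  (#|[pred ro | (ro, h s ro, s) \in Pr]| + (#|[pred ro | (ro, c1, f ro c1) \in Pr]| + 0)))))
  < n.
  move: k0 k1 k2 k3 k4 k5; rewrite !size_map sCL.
  move: #|_| #|_| #|_| #|_| #|_| #|_|.
  by clear; move: n e; lia.
have [ro] := @exists_avoid T [:: (fun ro => row_poor d ro); (fun ro => ro \in rows CL);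
  (fun ro => h s ro \in cols CL); (fun ro => f ro c1 \in syms CL);
  (fun ro => (ro, h s ro, s) \in Pr); (fun ro => (ro, c1, f ro c1) \in Pr)] lt.
move=> /and5P[a1 a2 a3 a4 /and3P[b1 b2 _]]; exists ro; split=> //; first by apply/and3P.
by rewrite /= b1 b2.
Qed.

Lemma choose_col CL d : size CL = 16 -> #|[pred ga | col_poor d ga]| + (48 + 2 * e) < n ->
  exists ga, [/\ ~~ col_poor d ga, [&& ga \notin cols CL, g ga s \notin rows CL
    & f r1 ga \notin syms CL] & all (fun u => u \notin Pr) (col_branch f g c s ga)].
Proof.
move=> sCL k0.
have k1 := card_inj_mem (cols CL) (@inj_id T).
have k2 := card_inj_mem (rows CL) (@g1I s).
have k3 := card_inj_mem (syms CL) (@f2I r1).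
have k4 : #|[pred ga | (g ga s, ga, s) \in Pr]| <= e.
  by apply: (@line_sym (fun ga => (g ga s, ga, s)) s) => // ? ? [].
have k5 : #|[pred ga | (r1, ga, f r1 ga) \in Pr]| <= e.
  by apply: (@line_row (fun ga => (r1, ga, f r1 ga)) r1) => // ? ? [].
have lt : #|[pred ga | col_poor d ga]| + (#|[pred ga | ga \in cols CL]| +
  (#|[pred ga | g ga s \in rows CL]| + (#|[pred ga | f r1 ga \in syms CL]| +
  (#|[pred ga | (g ga s, ga, s) \in Pr]| + (#|[pred ga | (r1, ga, f r1 ga) \in Pr]| + 0)))))
  < n.
  move: k0 k1 k2 k3 k4 k5; rewrite !size_map sCL.
  move: #|_| #|_| #|_| #|_| #|_| #|_|.
  by clear; move: n e; lia.
have [ga] := @exists_avoid T [:: (fun ga => col_poor d ga); (fun ga => ga \in cols CL);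
  (fun ga => g ga s \in rows CL); (fun ga => f r1 ga \in syms CL);
  (fun ga => (g ga s, ga, s) \in Pr); (fun ga => (r1, ga, f r1 ga) \in Pr)] lt.
move=> /and5P[a1 a2 a3 a4 /and3P[b1 b2 _]]; exists ga; split=> //; first by apply/and3P.
by rewrite /= b1 b2.
Qed.

Lemma exists_placement : exists R, [/\ uniq R, size R = 46, trade (r, c, s) R
  & forall u, u \in R -> lmem f u /\ u \notin Pr].
Proof.
have [d [/and4P[dc dc1 rr1 qr1] PC fR fC]] := choose_column.
set CL := column_level f g h r c s d in PC.
have [ro [pR /and3P[ro1 ro2 ro3] PR]] := @choose_row CL d erefl fR.
set RL := row_branch f h r s ro ++ row_fixed f g h r s d ro.
have [ga [pC /and3P[ga1 ga2 ga3] PG]] := @choose_col (CL ++ RL) d erefl fC.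
move: pR; rewrite !negb_or -!ltnNge => /and3P[b1 b2 e1].
move: pC; rewrite !negb_or -!ltnNge => /and3P[b3 b4 e2].
have uL := uniq_levels L rcs dc dc1 rr1 qr1 ro1 ro2 ro3 e1 ga1 ga2 ga3 e2.
have [m1 m2 m3 m4] := levels_distinct ro1 ro3 ga1 ga2.
have [R [uR sR tR RG]] := place_triple L G_sub G_good W_sym W_col W_row uL m1 m2 m3 m4 b1 b2 b3 b4.
exists R; split=> // u /RG[uN|uG]; last first.
  by case: u uG => [[i j] k] /[dup] /G_sub fk /G_avoid ->; rewrite /lmem /= fk eqxx.
split; last by move: uN; rewrite !mem_cat => /or3P[]; move: u; apply/allP.
move: u uN; apply/allP; rewrite !all_cat /= /lmem /=.
by rewrite !(fg, fh) !eqxx.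
Qed.

End Step.

(** * The base square *)

Lemma latin3_inj (T : finType) (f : T -> T -> T) :
  (forall i, injective (f i)) -> (forall j, injective (f^~ j)) ->
  exists g h, latin3 f g h.
Proof.
move=> I J; exists (fun j => invF (J j)), (fun k i => invF (I i) k) => i j k.
split; apply/eqP/eqP => [<-|<-].
- exact: (invF_f (J j)).
- exact: (f_invF (J j)).
- exact: (invF_f (I i)).
- exact: (f_invF (I i)).
Qed.

Section BaseSquare.
Local Open Scope ring_scope.
Variable Z : finComNzRingType.
Hypothesis double_inj : injective (fun z : Z => z + z).
Variables (Q : finType) (iota : Q -> Z) (corner : Q -> Q -> Q).
Hypothesis iota_inj : injective iota.
Hypothesis corner_inj1 : forall t, injective (corner t).
Hypothesis corner_inj2 : forall t, injective (corner^~ t).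

Notation V := (bool * bool)%type.
Notation X := (V * Z)%type.
Implicit Types (u v w : V) (a b : X) (t : Q).

Definition vadd u v : V := (u.1 (+) v.1, u.2 (+) v.2).
Definition vzero u := ~~ u.1 && ~~ u.2.
Definition sympl u v := (u.1 && v.2) (+) (u.2 && v.1).
Definition sg (b : bool) (z : Z) := if b then - z else z.

Definition sq a b : X :=
  (vadd a.1 b.1, sg (vzero b.1) a.2 + sg (sympl a.1 b.1) b.2).

Lemma sgK e : involutive (sg e).
Proof. by case: e => z; rewrite /sg ?opprK. Qed.

Lemma sg_inj e : injective (sg e).
Proof. exact: inv_inj (sgK e). Qed.

Lemma vaddK u v : vadd u (vadd u v) = v.
Proof. by case: u v => [[] []] [[] []]. Qed.

Lemma vaddC u v : vadd u v = vadd v u.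
Proof. by rewrite /vadd addbC (addbC u.2). Qed.

Lemma sq_inj1 a : injective (sq a).
Proof.
move=> [v j] [v' j'] [e1 e2 e3].
have ev : v = v' by rewrite -(vaddK a.1 v) -(vaddK a.1 v') /vadd e1 e2.
by subst v'; move/addrI/sg_inj: e3 => ->.
Qed.

Lemma sq_inj2 b : injective (sq^~ b).
Proof.
move=> [u i] [u' i'] [e1 e2 e3].
have eu : u = u'.
  by rewrite -(vaddK b.1 u) -(vaddK b.1 u') ![vadd b.1 (_ _ _)]/vadd /= !(addbC (_ b.1)) e1 e2.
by subst u'; move/addIr/sg_inj: e3 => ->.
Qed.

(* The signs in [sq] are chosen for this: [vzero b.1] and the symplectic form make the two linear
   equations for the fourth corner proportional. *)
Lemma sq_intercalate a b c : ~~ vzero (vadd (vadd a.1 b.1) c.1) ->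
  exists a' b' c', [&& a != a', b != b', c != c', sq a b == c', sq a b' == c, sq a' b == c
    & sq a' b' == c'].
Proof.
case: a b c => [u i] [v j] [w k] /= nz.
(* The first two witnesses are forced by [sq a' b = c] and [sq a b' = c]; only the fourth corner has
   to be checked. The nonzero class sum makes old and new rows, columns and symbols differ. *)
exists (vadd v w, sg (vzero v) (k - sg (sympl (vadd v w) v) j)).
exists (vadd u w, sg (sympl u (vadd u w)) (k - sg (vzero (vadd u w)) i)).
exists (sq (u, i) (v, j)).
move: nz; rewrite /sq /= eqxx !xpair_eqE.
move: u v w => [[] []] [[] []] [[] []] //= _; rewrite /vzero /sympl /vadd /sg /= ?eqxx /=;
 rewrite ?andbT; repeat (apply/andP; split=> //); apply/eqP; ring.
Qed.

Definition rotV u : V := (u.2, u.1 (+) u.2).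
Definition rotVi u : V := (u.1 (+) u.2, u.1).

Lemma rotVK : cancel rotV rotVi. Proof. by move=> [[] []]. Qed.

Lemma rotViK : cancel rotVi rotV. Proof. by move=> [[] []]. Qed.

(* On classes, [rotV] is multiplication by a generator of the unit group of the field F_4, so both
   [rotV] and [u + rotV u] are bijective: the cells [(a, transv z a)] form a transversal of [sq]. *)
Definition transv (z : Z) a : X :=
  (rotV a.1, sg (sympl a.1 (rotV a.1)) (sg (vzero (rotV a.1)) a.2 + z)).

Definition transv_inv (z : Z) b : X :=
  (rotVi b.1, sg (vzero b.1) (sg (sympl (rotVi b.1) b.1) b.2 - z)).

Lemma transvK z : cancel (transv z) (transv_inv z).
Proof. by move=> [u i]; rewrite /transv /transv_inv /= rotVK sgK addrK sgK. Qed.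

Lemma transv_invK z : cancel (transv_inv z) (transv z).
Proof. by move=> [u i]; rewrite /transv /transv_inv /= rotViK sgK subrK sgK. Qed.

Lemma transv_injz a z z' : transv z a = transv z' a -> z = z'.
Proof. by case=> /sg_inj/addrI. Qed.

(** Along the transversal the signs cancel, and the [Z]-component of the entry becomes twice the
    signed [i] plus [z]. This is where doubling must be injective, that is, where [Z] must have odd
    order. *)
Lemma sq_transv_inj z : injective (fun a => sq a (transv z a)).
Proof.
move=> [u i] [u' i']; rewrite /sq /transv /= !sgK => -[e1 e2 e3].
have eu : u = u' by move: u u' e1 e2 {e3} => [[] []] [[] []].
subst u'; move: e3; rewrite !addrA => /addIr/double_inj/sg_inj -> //.
Qed.

Notation T := (X + Q)%type.

(* Each symbol [inr t] replaces the entries of one transversal; the displaced entries go to the new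
   column and the new row [inr t]. *)
Definition prolong (p p' : T) : T :=
  match p, p' with
  | inl a, inl b => if [pick t | transv (iota t) a == b] is Some t then inr t else inl (sq a b)
  | inl a, inr t => inl (sq a (transv (iota t) a))
  | inr t, inl b => inl (sq (transv_inv (iota t) b) b)
  | inr t, inr t' => inr (corner t t')
  end.

Let inlI : injective (@inl X Q). Proof. by move=> ? ? []. Qed.
Let inrI : injective (@inr X Q). Proof. by move=> ? ? []. Qed.

Lemma prolong_inj1 p : injective (prolong p).
Proof.
case: p => [a|t] [b|t1] [b'|t2] //=.
- case: pickP => [t /eqP tb|nb]; case: pickP => [t' /eqP tb'|nb'] //.
    by move=> /inrI e; rewrite -tb -tb' e.
  by move=> /inlI/sq_inj1 ->.
- case: pickP => // nb /inlI/sq_inj1 e1; by have := nb t2; rewrite e1 eqxx.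
- case: pickP => // nb /inlI/sq_inj1 e1; by have := nb t1; rewrite e1 eqxx.
- by move=> /inlI/sq_inj1/transv_injz/iota_inj ->.
- move=> /inlI e; congr inl; apply: (can_inj (transv_invK (iota t))).
  by apply: (@sq_transv_inj (iota t)); rewrite !transv_invK.
- by move=> /inrI/corner_inj1 ->.
Qed.

Lemma prolong_inj2 p : injective (prolong^~ p).
Proof.
case: p => [b|t] [a|t1] [a'|t2] //=.
- case: pickP => [t /eqP tb|nb]; case: pickP => [t' /eqP tb'|nb'] //.
    by move=> /inrI e; congr inl; apply: (can_inj (transvK (iota t))); rewrite tb e tb'.
  by move=> /inlI/sq_inj2 ->.
- case: pickP => // nb /inlI/sq_inj2 e1; by have := nb t2; rewrite e1 transv_invK eqxx.
- case: pickP => // nb /inlI/sq_inj2 e1; by have := nb t1; rewrite -e1 transv_invK eqxx.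
- move=> /inlI/sq_inj2 e; congr inr; apply: iota_inj.
  apply: (@transv_injz (transv_inv (iota t1) b)); by rewrite {2}e !transv_invK.
- by move=> /inlI/sq_transv_inj ->.
- by move=> /inrI/corner_inj2 ->.
Qed.

(** The square before prolongation, as a partial square on the larger set; its intercalates are the
    ones switched later. *)
Definition base (p p' p'' : T) :=
  if (p, p', p'') is (inl a, inl b, inl c) then sq a b == c else false.

(** The quarter of the regular triples to which [sq_intercalate] does not apply. *)
Definition zero_class (p p' p'' : T) := if (p, p', p'') is (inl a, inl b, inl c)
  then vzero (vadd (vadd a.1 b.1) c.1) else false.

Definition regular (p : T) := if p is inl _ then true else false.

(** Prolongation destroys base triples only on the chosen transversals, which bounds their number by
    that of the pairs in [X * Q]. *)
Lemma base_prolong p p' p'' : base p p' p'' -> prolong p p' != p'' ->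
  exists u : X * Q, (p, p') = (inl u.1, inl (transv (iota u.2) u.1)).
Proof.
case: p p' p'' => [a|t] [b|t'] [d|t''] //= /eqP <-.
case: pickP => [t /eqP <-|_]; last by rewrite eqxx.
by exists (a, t).
Qed.

Lemma zero_classC p p' p'' : zero_class p p' p'' = zero_class p' p p''.
Proof. by case: p p' p'' => [a|t] [b|t'] [d|t''] //=; rewrite /zero_class (vaddC a.1). Qed.

Lemma zero_classCA p p' p'' : zero_class p p' p'' = zero_class p p'' p'.
Proof.
by case: p p' p'' => [[[[] []] ?]|t] [[[[] []] ?]|t'] [[[[] []] ?]|t''].
Qed.

Lemma card_zero_class p p' : (#|[pred p'' | zero_class p p' p'']| <= #|Z|)%N.
Proof.
case: p p' => [a|t] [b|t']; rewrite /zero_class; try by rewrite (@eq_card0 T).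
apply: leq_trans (leq_image_card (fun z : Z => inl (vadd a.1 b.1, z) : T) Z).
apply: subset_leq_card; apply/subsetP => -[[w k]|//]; rewrite inE /= => w0.
apply/imageP; exists k => //; congr (inl (_, _)).
by move: w0; case: (vadd _ _) w => [[] []] [[] []].
Qed.

End BaseSquare.

(** * Inserting the entries one by one *)

(** The constants of the theorem are balanced here. Multiplying out, [30 * B] is at most (1470 +
    5640 e) n^2; the density gives 5640 e <= 0.94 n, and 0.06 n exceeds 1500. *)
Lemma bad_arith (n e D B : nat) : 25 * 1000 < n -> 6 * 1000 * e <= n ->
  D <= 7 * n + 47 * (n * e) -> B <= 4 * (D * n) + 3 * (7 * (n * n)) -> 30 * B <= n ^ 3.
Proof.
rewrite !expnS expn0 muln1 => n0 he hD hB.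
have h : 1470 + 47 * 120 * e <= n by lia.
have hDn : D * n <= (7 * n + 47 * (n * e)) * n by rewrite leq_mul2r hD orbT.
have e1 : (7 * n + 47 * (n * e)) * n = 7 * (n * n) + 47 * (e * (n * n)) by ring.
have : (1470 + 47 * 120 * e) * (n * n) <= n * (n * n) by rewrite leq_mul2r h orbT.
have -> : (1470 + 47 * 120 * e) * (n * n) = 1470 * (n * n) + 47 * 120 * (e * (n * n)) by ring.
move: hDn hB; rewrite e1; lia.
Qed.

Section Iteration.
Variable T : finType.
Let n := #|T|.
Hypothesis n_big : 25 * 1000 < n.
Variables (M W : T -> T -> T -> bool) (reg : pred T).
Hypothesis M_sym : forall i j k k', M i j k -> M i j k' -> k = k'.
Hypothesis M_col : forall i j j' k, M i j k -> M i j' k -> j = j'.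
Hypothesis W_sym : forall i j, 4 * #|[pred k | W i j k]| <= n.
Hypothesis W_col : forall i k, 4 * #|[pred j | W i j k]| <= n.
Hypothesis W_row : forall j k, 4 * #|[pred i | W i j k]| <= n.
Hypothesis reg_big : #|[pred i | ~~ reg i]| <= 7.
Hypothesis M_good : forall i j k, reg i -> reg j -> reg k -> ~~ W i j k -> good M i j k.

Definition goodb (G : T -> T -> T -> bool) i j k := [exists u : T * T * T,
  [&& i != u.1.1, j != u.1.2, k != u.2, G i j u.2, G i u.1.2 k, G u.1.1 j k
    & G u.1.1 u.1.2 u.2]].

Lemma goodP G i j k : reflect (good G i j k) (goodb G i j k).
Proof.
apply: (iffP existsP) => [[[[i' j'] k'] /= H]|[i' [j' [k' H]]]]; first by exists i', j', k'.
by exists (i', j', k').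
Qed.

(** Triples in [W] with regular coordinates are not counted: [W] is bounded on every line, whereas
    [bad] is only bounded in total. *)
Definition bad (G : T -> T -> T -> bool) i j k :=
  ~~ [&& reg i, reg j & reg k] || (~~ W i j k && ~~ goodb G i j k).

(** A bad regular triple outside [W] has an intercalate in [M] with one of its four triples missing
    from [G]. For each of the four positions, the missing triple and one further coordinate
    determine the bad one. Irregular coordinates account for the last summand. *)
Lemma card_bad (G : T -> T -> T -> bool) :
  #|cells (bad G)| <= 4 * (#|[pred u | cells M u && ~~ cells G u]| * n) + 3 * (7 * (n * n)).
Proof.
set D := [pred u | _].
(* For the opposite corner [(i', j', k')], the row [i] is the further coordinate: [M i j k'] then
   gives [j], and [M i j' k] gives [k]. The default [i] at most enlarges the covering set. *)
pose jM i k := odflt i [pick j | M i j k]; pose kM i j := odflt i [pick k | M i j k].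
have jME i j k : M i j k -> jM i k = j.
  move=> m; rewrite /jM; case: pickP => [j' m'|/(_ j)]; last by rewrite m.
  exact: M_col m' m.
have kME i j k : M i j k -> kM i j = k.
  move=> m; rewrite /kM; case: pickP => [k' m'|/(_ k)]; last by rewrite m.
  exact: M_sym m' m.
pose img (phi : (T * T * T) * T -> T * T * T) := [set phi p | p in [predX D & T]].
have cimg phi : #|img phi| <= #|D| * n.
  by rewrite -[leqRHS](cardX D T); exact: leq_imset_card.
have creg (P : pred T) : #|P| <= 7 -> forall phi : T * (T * T) -> T * T * T,
    #|[set phi p | p in [predX P & {: T * T}]]| <= 7 * (n * n).
  move=> P7 phi; apply: leq_trans (leq_imset_card _ _) _.
  by rewrite cardX card_prod leq_mul2r P7 orbT.
pose nr := [pred i | ~~ reg i].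
pose S := (img (fun p => (p.1.1.1, p.1.1.2, p.2)) :|: img (fun p => (p.1.1.1, p.2, p.1.2))) :|:
  (img (fun p => (p.2, p.1.1.2, p.1.2)) :|:
   img (fun p => (p.2, jM p.2 p.1.2, kM p.2 p.1.1.2))) :|:
  ([set (p.1, p.2.1, p.2.2) | p in [predX nr & {: T * T}]] :|:
   ([set (p.2.1, p.1, p.2.2) | p in [predX nr & {: T * T}]] :|:
    [set (p.2.1, p.2.2, p.1) | p in [predX nr & {: T * T}]])).
have sub : cells (bad G) \subset S.
  apply/subsetP => -[[i j] k] Hb; have {Hb} : bad G i j k := Hb; rewrite /bad.
  have [r|r] := boolP [&& reg i, reg j & reg k]; rewrite /= => Hb.
    have [w b] := andP Hb. have /and3P[ri rj rk] := r.
    have [i' [j' [k' /and5P[ni nj nk m1 /and3P[m2 m3 m4]]]]] := M_good ri rj rk w.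
    have memD u (z : T) : cells M u -> ~~ cells G u -> (u, z) \in [predX D & T].
      by move=> a a'; rewrite !inE /= a a'.
    have : ~~ [&& G i j k', G i j' k, G i' j k & G i' j' k'].
      apply: contraNN b => /and4P[a1 a2 a3 a4]; apply/goodP; exists i', j', k'.
      by rewrite ni nj nk a1 a2 a3 a4.
    rewrite !negb_and !inE => /or4P[] nG.
    - by rewrite (imset_f _ (memD (i, j, k') k m1 nG)).
    - by rewrite (imset_f (fun p => (p.1.1.1, p.2, p.1.2)) (memD (i, j', k) j m2 nG)) ?orbT.
    - by rewrite (imset_f (fun p => (p.2, p.1.1.2, p.1.2)) (memD (i', j, k) i m3 nG)) ?orbT.
    - have := imset_f (fun p => (p.2, jM p.2 p.1.2, kM p.2 p.1.1.2)) (memD (i', j', k') i m4 nG).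
      by rewrite /= (jME _ _ _ m1) (kME _ _ _ m2) => ->; rewrite ?orbT.
  have memN (P : pred T) z zz : P z -> (z, zz) \in [predX P & {: T * T}].
    by move=> Pz; rewrite !inE andbT.
  move: r {Hb}; rewrite !negb_and !inE => /or3P[] r.
  - by rewrite (imset_f (fun p => (p.1, p.2.1, p.2.2)) (memN nr i (j, k) r)) ?orbT.
  - by rewrite (imset_f (fun p => (p.2.1, p.1, p.2.2)) (memN nr j (i, k) r)) ?orbT.
  - by rewrite (imset_f (fun p => (p.2.1, p.2.2, p.1)) (memN nr k (i, j) r)) ?orbT.
apply: leq_trans (subset_leq_card sub) _.
have U (A A' : {set T * T * T}) p q : #|A| <= p -> #|A'| <= q -> #|A :|: A'| <= p + q.
  by move=> hA hA'; apply: leq_trans (leq_card_setU _ _) (leq_add hA hA').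
have -> : 4 * (#|D| * n) + 3 * (7 * (n * n)) =
  (#|D| * n + #|D| * n) + (#|D| * n + #|D| * n) +
  (7 * (n * n) + (7 * (n * n) + 7 * (n * n))) by ring.
rewrite /S; apply: (U); first by apply: (U); apply: (U); exact: cimg.
by apply: (U); [|apply: (U)]; exact: creg.
Qed.

Variables (f0 : T -> T -> T) (P : {set T * T * T}) (e : nat).
Hypothesis M_f0 : #|[pred u | cells M u && ~~ lmem f0 u]| <= 7 * n.
Hypothesis e_small : 6 * 1000 * e <= n.
Hypothesis P_row : forall i, #|[set u in P | u.1.1 == i]| <= e.
Hypothesis P_col : forall j, #|[set u in P | u.1.2 == j]| <= e.
Hypothesis P_sym : forall k, #|[set u in P | u.2 == k]| <= e.
Hypothesis P_cell : forall i j k k', (i, j, k) \in P -> (i, j, k') \in P -> k = k'.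
Hypothesis P_rowsym : forall i j j' k, (i, j, k) \in P -> (i, j', k) \in P -> j = j'.
Hypothesis P_colsym : forall i i' j k, (i, j, k) \in P -> (i', j, k) \in P -> i = i'.

Lemma card_P : #|P| <= n * e.
Proof.
rewrite -sum1_card (partition_big (fun u => u.1.1) xpredT) //=.
rewrite -[n]sum1_card big_distrl /=; apply: leq_sum => i _.
rewrite mul1n; apply: leq_trans (P_row i); rewrite -sum1_card.
by apply: eq_leq; apply: eq_bigl => u; rewrite !inE.
Qed.

Lemma place_next f g h r c s : latin3 f g h ->
  #|[pred u | lmem f0 u && ~~ lmem f u]| <= 46 * (n * e) -> (r, c, s) \in P -> f r c != s ->
  exists R, [/\ uniq R, size R = 46, trade (r, c, s) R
    & forall u, u \in R -> lmem f u /\ u \notin P].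
Proof.
move=> L near rcsP rcs.
pose Pr := P :&: [set u | lmem f u].
pose G i j k := [&& M i j k, f i j == k & (i, j, k) \notin Pr].
have PrP u : u \in Pr -> u \in P by rewrite inE => /andP[].
have lineP (p : T * T * T -> T) i : #|[set u in P | p u == i]| <= e ->
    #|[set u in Pr | p u == i]| <= e.
  apply: leq_trans; apply: subset_leq_card; apply/subsetP => u; rewrite !inE.
  by case/andP=> /andP[-> _] ->.
have bG : 30 * #|cells (bad G)| <= n ^ 3.
  apply: bad_arith n_big e_small _ (card_bad G).
  have sub : {subset [pred u | cells M u && ~~ cells G u] <=
      [pred u | (cells M u && ~~ lmem f0 u) || ((lmem f0 u && ~~ lmem f u) || (u \in P))]}.
    case=> [[i j] k]; rewrite !inE /cells /G /lmem /= => /andP[-> /=].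
    case: (f0 i j == k) => //=; case: (f i j == k) => //=; rewrite ?orbT //.
    by rewrite !inE /= negbK => /andP[].
  apply: leq_trans (subset_leq_card (introT subsetP sub)) _.
  apply: leq_trans (card_predU_le _ _) (leq_add M_f0 _).
  apply: leq_trans (card_predU_le _ _) _.
  have -> : 47 * (n * e) = 46 * (n * e) + n * e by rewrite mulSn addnC.
  exact: leq_add near card_P.
have [i j k|i j k|i j k w b||||R [uR sR tR RG]] := @exists_placement T n_big f g h G W (bad G) Pr r c s e
  L e_small bG _ _ _ W_sym W_col W_row (fun i => lineP (fun u => u.1.1) i (P_row i))
  (fun i => lineP (fun u => u.1.2) i (P_col i)) (fun i => lineP snd i (P_sym i)) rcs.
- by case/and3P => _ /eqP.
- by case/and3P.
- by move: b; rewrite negb_or negbK => /andP[_]; rewrite w /= negbK => /goodP.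
(* The three triples of the square sharing two coordinates with [(r, c, s)] must go; none is in [P],
   as [P] has no conflicting entries. *)
- by apply: contraNN rcs => /PrP /P_cell /(_ rcsP) ->.
- apply: contraNN rcs => /PrP /P_rowsym /(_ rcsP) e1.
  by rewrite (L r c s).2 e1.
- apply: contraNN rcs => /PrP /P_colsym /(_ rcsP) e1.
  by rewrite (L r c s).1 e1.
exists R; split=> // u /RG[uf uP]; split=> //.
by move: uP; rewrite !inE uf andbT.
Qed.

Lemma complete g0 h0 : latin3 f0 g0 h0 ->
  exists f g h, latin3 f g h /\ forall u, u \in P -> lmem f u.
Proof.
move=> L0.
(* Invariant: at most [m] entries of [P] are missing, and a budget of 46 losses is still available
   for each of them. *)
suff IH m f g h : latin3 f g h -> #|[pred u | (u \in P) && ~~ lmem f u]| <= m ->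
    #|[pred u | lmem f0 u && ~~ lmem f u]| + 46 * m <= 46 * (n * e) ->
    exists f g h, latin3 f g h /\ forall u, u \in P -> lmem f u.
  apply: (IH (n * e) f0 g0 h0 L0).
    apply: leq_trans (subset_leq_card _) card_P.
    by apply/subsetP => u; rewrite inE => /andP[].
  by rewrite (@eq_card0 _ _) // => u; rewrite !inE andbN.
elim: m f g h => [|m IH] f g h L hm near.
  exists f, g, h; split=> // u uP; apply: contraTT hm => fu; rewrite -ltnNge.
  by apply/card_gt0P; exists u; rewrite inE uP.
have [[[r c] s] /= /andP[uP fu]|all] := pickP [pred u | (u \in P) && ~~ lmem f u]; last first.
  by exists f, g, h; split=> // u uP; have := all u; rewrite /= uP => /negbFE.
have [|R [uR sR tR RG]] := place_next L _ uP fu; first exact: leq_trans (leq_addr _ _) near.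
have [u /RG[] //||f' [g' [h' [L' ft keep]]]] := apply_trade L tR uR _ _.
  by apply: contraNN fu => /RG[].
apply: IH L' _ _.
  rewrite -ltnS; apply: leq_trans hm; apply: proper_card; apply/properP; split.
    apply/subsetP => u; rewrite !inE => /andP[uP' /=]; rewrite uP'; apply: contraNN => fu'.
    by apply: keep => //; apply/negP => /RG[_]; rewrite uP'.
  by exists (r, c, s); rewrite !inE uP //= ft.
apply: leq_trans near; rewrite mulnS addnCA addnA leq_add2r.
have sub : {subset [pred u | lmem f0 u && ~~ lmem f' u] <=
    [pred u | (u \in R) || (lmem f0 u && ~~ lmem f u)]}.
  move=> u; rewrite !inE => /andP[-> /=]; apply: contraNT; rewrite negb_or negbK.
  by case/andP=> uR' fu'; exact: keep.
apply: leq_trans (subset_leq_card (introT subsetP sub)) _.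
apply: leq_trans (card_predU_le _ _) _; rewrite leq_add2r -sR.
by apply: leq_trans (card_size R); apply: eq_leq; apply: eq_card => u; rewrite !inE.
Qed.

End Iteration.

(** * The base square for a given order *)

Section OddModulus.
Variable k : nat.

Lemma ord_double_inj : injective (fun z : 'I_(k.*2.+1).+2 => (z + z)%R).
Proof.
move=> z z' /(congr1 (fun x : 'I_(k.*2.+1).+2 => x *+ k.+2)%R).
have mz (x : 'I_(k.*2.+1).+2) : ((x + x) *+ k.+2 = x)%R.
  rewrite -mulr2n -mulrnA.
  (* The modulus is 2k + 3, so k + 2 is the inverse of 2. *)
  have -> : 2 * k.+2 = (k.*2.+1).+2 + 1 by lia.
  rewrite mulrnDr mulr1n -mulr_natr; set y := _%:R%R.
  have -> : y = 0%R by apply: val_inj; rewrite /y Zp_nat /= modnn.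
  by rewrite mulr0 add0r.
by rewrite /= !mz.
Qed.

End OddModulus.

Section Corner.
Variable q : nat.

Lemma corner_proof (t t' : 'I_q) : (t + t') %% q < q.
Proof. by rewrite ltn_pmod // (leq_ltn_trans _ (ltn_ord t)). Qed.

Definition cyc (t t' : 'I_q) := Ordinal (corner_proof t t').

Lemma cyc_inj1 t : injective (cyc t).
Proof.
move=> x y /(congr1 val) /= /eqP; rewrite eqn_modDl !modn_small // => /eqP.
exact: val_inj.
Qed.

Lemma cyc_inj2 t : injective (cyc^~ t).
Proof.
move=> x y /(congr1 val) /= /eqP; rewrite eqn_modDr !modn_small // => /eqP.
exact: val_inj.
Qed.

End Corner.

Lemma exists_base n : 25 * 1000 < n -> exists (T : finType) (f g h : T -> T -> T)
    (M W : T -> T -> T -> bool) (reg : pred T),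
  #|T| = n /\ latin3 f g h /\
  [/\ forall i j k k', M i j k -> M i j k' -> k = k',
      forall i j j' k, M i j k -> M i j' k -> j = j',
      forall i j k, reg i -> reg j -> reg k -> ~~ W i j k -> good M i j k,
      #|[pred i | ~~ reg i]| <= 7
    & #|[pred u | cells M u && ~~ lmem f u]| <= 7 * n] /\
  [/\ forall i j, 4 * #|[pred k | W i j k]| <= n,
      forall i k, 4 * #|[pred j | W i j k]| <= n
    & forall j k, 4 * #|[pred i | W i j k]| <= n].
Proof.
(* Writing n = 12 + 8m + q gives n = 4(2m + 3) + q with an odd modulus 2m + 3 and q <= 7. *)
move=> n_big; pose q := (n - 12) %% 8; pose m := (n - 12) %/ 8.
have q7 : q <= 7 by rewrite -ltnS ltn_pmod.
have nE : n = 4 * (m.*2.+1).+2 + q.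
  by have := divn_eq (n - 12) 8; rewrite -/m -/q; lia.
have qm : q <= (m.*2.+1).+2 by lia.
pose Z : finComNzRingType := 'I_(m.*2.+1).+2.
pose iota : 'I_q -> Z := widen_ord qm.
have iotaI : injective iota by move=> x y /(congr1 val) /= /val_inj.
have dI : injective (fun z : Z => z + z)%R := @ord_double_inj m.
have cZ : #|Z| = (m.*2.+1).+2 by rewrite card_ord.
have cV : #|{: bool * bool}| = 4 by rewrite card_prod card_bool.
pose T : finType := (bool * bool * Z + 'I_q)%type.
pose f : T -> T -> T := prolong iota (@cyc q).
have [g [h L]] : exists g h, latin3 f g h.
  apply: latin3_inj => p.
    exact: (prolong_inj1 dI iotaI (@cyc_inj1 q)).
  exact: (prolong_inj2 dI iotaI (@cyc_inj2 q)).
have cT : #|T| = n by rewrite card_sum card_prod cV cZ card_ord -nE.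
exists T, f, g, h, (@base Z 'I_q), (@zero_class Z 'I_q), (@regular Z 'I_q).
split=> //; split=> //.
have Wle (p p' : T) : 4 * #|[pred p'' | zero_class p p' p'']| <= n.
  by have := card_zero_class p p'; rewrite cZ; move: #|_|; lia.
split; last first.
  split=> // p p''.
    by rewrite (eq_card (B := [pred j | zero_class p p'' j])) ?Wle // => j;
      rewrite !inE zero_classCA.
  rewrite (eq_card (B := [pred j | zero_class p p'' j])) ?Wle // => j.
  by rewrite !inE zero_classC zero_classCA.
split.
- by move=> [a|t] [b|t'] [c|t''] [d|t3] //= /eqP <- /eqP <-.
- move=> [a|t] [b|t'] [b'|t''] [d|t3] //= /eqP e /eqP e'; congr inl.
  by apply: (@sq_inj1 Z a); rewrite e e'.
- move=> [a|t] [b|t'] [c|t''] //= _ _ _ /sq_intercalate [a' [b' [c' H]]].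
  by exists (inl a'), (inl b'), (inl c').
- apply: leq_trans q7; rewrite -[X in _ <= X]card_ord.
  apply: leq_trans (leq_image_card (fun t : 'I_q => inr t : T) 'I_q).
  apply: subset_leq_card; apply/subsetP => -[|t] //= _; exact: image_f.
pose phi (u : bool * bool * Z * 'I_q) : T * T * T :=
  let b := transv (iota u.2) u.1 in (inl u.1, inl b, inl (sq u.1 b)).
apply: (@leq_trans #|{: bool * bool * Z * 'I_q}|).
  apply: leq_trans (leq_image_card phi _); apply: subset_leq_card.
  apply/subsetP => -[[p p'] p'']; rewrite inE => /andP[/= bp fp].
  have [[a t] /= [e1 e2]] := base_prolong bp fp.
  move: bp; rewrite /cells /= e1 e2; case: p'' {fp} => // d /eqP <-.
  exact: (image_f phi (x := (a, t))).
rewrite !card_prod card_bool cZ card_ord; nia.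
Qed.

(** * Back to matrices: the theorem *)

Lemma card_dense n c N : (0 < N)%N -> (c%:R <= 1 / N%:R * n%:R :> rat)%R -> (c <= n %/ N)%N.
Proof.
move=> N0; rewrite leq_divRL // -(ler_nat rat) mul1r mulrC ler_pdivlMr ?ltr0n //.
by rewrite natrM.
Qed.

(** Integer form of the theorem. Enumerating the carrier of the base square turns the filled cells
    of [P] into a set of triples, to which [complete] applies. *)
Lemma sparse_completable (n e : nat) (P : 'M[option 'I_n]_n) :
  25 * 1000 < n -> 6 * 1000 * e <= n -> partial_latin_square P ->
  (forall i, #|[set j | P i j != None]| <= e) ->
  (forall j, #|[set i | P i j != None]| <= e) ->
  (forall s, #|[set c : 'I_n * 'I_n | P c.1 c.2 == Some s]| <= e) ->
  completable P.
Proof.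
move=> n_big e_small [hP1 hP2] P_row P_col P_sym.
have [T [f0 [g0 [h0 [M [W [reg [cT [L0 [[M1 M2 M3 M4 M5] [W1 W2 W3]]]]]]]]]]] := exists_base n_big.
subst n.
pose be (x : T) : 'I_#|T| := enum_rank x; pose al (i : 'I_#|T|) : T := enum_val i.
have beI : injective be := @enum_rank_inj T.
have alK : cancel al be := @enum_valK T.
have beK : cancel be al := @enum_rankK T.
pose PT := [set u : T * T * T | P (be u.1.1) (be u.1.2) == Some (be u.2)].
have [|||||| f [g [h [L PL]]]] := @complete T n_big M W reg M1 M2 W1 W2 W3 M4 M3 f0 PT
  e M5 e_small _ _ _ _ _ _ g0 h0 L0.
- move=> x; apply: leq_trans (P_row (be x)).
  rewrite -(@card_in_imset _ _ (fun u => be u.1.2)) => [|[[i j] k] [[i' j'] k']].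
    apply: subset_leq_card; apply/subsetP => _ /imsetP[[[i j] k] + ->].
    by rewrite !inE /= => /andP[/eqP + /eqP <-] => ->.
  rewrite !inE /= => /andP[/eqP p /eqP ex] /andP[/eqP p' /eqP ex'] /beI ej.
  by move: p p'; rewrite ex ex' ej => -> [/beI ->].
- move=> x; apply: leq_trans (P_col (be x)).
  rewrite -(@card_in_imset _ _ (fun u => be u.1.1)) => [|[[i j] k] [[i' j'] k']].
    apply: subset_leq_card; apply/subsetP => _ /imsetP[[[i j] k] + ->].
    by rewrite !inE /= => /andP[/eqP + /eqP <-] => ->.
  rewrite !inE /= => /andP[/eqP p /eqP ex] /andP[/eqP p' /eqP ex'] /beI ej.
  by move: p p'; rewrite ex ex' ej => -> [/beI ->].
- move=> x; apply: leq_trans (P_sym (be x)).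
  rewrite -(@card_in_imset _ _ (fun u => (be u.1.1, be u.1.2))) => [|[[i j] k] [[i' j'] k']].
    apply: subset_leq_card; apply/subsetP => _ /imsetP[[[i j] k] + ->].
    by rewrite !inE /= => /andP[/eqP + /eqP <-] => ->.
  rewrite !inE /= => /andP[_ /eqP ex] /andP[_ /eqP ex'] [/beI -> /beI ->].
  by rewrite ex ex'.
- by move=> i j k k'; rewrite !inE /= => /eqP -> /eqP [/beI].
- by move=> i j j' k; rewrite !inE /= => /eqP p /eqP p'; exact: beI (hP1 _ _ _ _ p p').
- by move=> i i' j k; rewrite !inE /= => /eqP p /eqP p'; exact: beI (hP2 _ _ _ _ p p').
exists (\matrix_(i, j) be (f (al i) (al j)))%R; split.
  split=> [i j j'|j i i']; rewrite !mxE => /beI eq_f; apply: (can_inj alK).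
    by rewrite -(latin_hf L (al i) (al j)) eq_f (latin_hf L).
  by rewrite -(latin_gf L (al i) (al j)) eq_f (latin_gf L).
move=> i j s ps; rewrite mxE.
have : (al i, al j, al s) \in PT by rewrite !inE /= !alK ps.
by move/PL; rewrite /lmem /= => /eqP ->; rewrite alK.
Qed.

Local Open Scope ring_scope.

Theorem corollary4p1p3 (n : nat) (hn : (25000 < n)%N)
    (P : 'M[option 'I_n]_n) (hP : partial_latin_square P)
    (hdense : eps_dense (1 / 6000%:R) P) :
  completable P.
Proof.
have n_big : (25 * 1000 < n)%N := hn.
have N0 : (0 < 6000)%N := isT.
have [d1 d2 d3] := hdense.
apply: (@sparse_completable n (n %/ 6000) P n_big _ hP).
- rewrite (_ : (6 * 1000)%N = 6000); last exact: erefl.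
  by rewrite mulnC leq_trunc_div.
- by move=> i; exact: card_dense N0 (d1 i).
- by move=> j; exact: card_dense N0 (d2 j).
- by move=> s; exact: card_dense N0 (d3 s).
Qed.
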